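(* Suppose that $\liminf_{i\to\infty}q_i>0$, and that the replacement distributions $\boldsymbol\alpha^{(k)}$ on $\{1,\dots,k\}$, $k\ge1$, are such that there exist constants $N_1,N_2\ge1$ and $a>0$, independent of $k$, with $\sum_{j=1}^{\min\{N_1,k\}}\alpha_j^{(k)}\ge a$ for all $k\ge N_2$, where $N_1$ is such that either (a) $\tilde q_j<1$ for all $j\in\{1,\dots,N_1\}$, or (b) $\tilde q_j=1$ for all $j\in\{1,\dots,N_1\}$ and there is a path from any $j\in\{1,\dots,N_1\}$ to every initial type $i\in\mathcal S$. If $\rho(\bar M^{(k)})\le1$ for infinitely many $k$, then $\boldsymbol q=\boldsymbol 1$.
   Context: $\{\boldsymbol Z_n\}_{n\ge0}$ is a multitype Galton–Watson branching process with countably infinite type set $\mathcal S=\{1,2,3,\dots\}$, started from a single individual whose type is denoted $\varphi_0$. Each individual lives one generation and, at death, independently of all other individuals, an individual of type $i$ produces $\boldsymbol r=(r_1,r_2,\dots)$ offspring ($r_j$ of type $j$, finitely many $r_j$ nonzero) with probability $p_i(\boldsymbol r)$. $Z_{n,j}$ is the number of type-$j$ individuals in generation $n$ and $|\boldsymbol Z_n|=\sum_jZ_{n,j}$. Write $\mathbf P_i(\cdot)=\mathbf P(\cdot\mid\varphi_0=i)$. The mean progeny matrix is $M=(M_{ij})$, where $M_{ij}$ is the expected number of type-$j$ children of a type-$i$ parent; its row sums are assumed finite. There is a path from $i$ to $j$ if there is a directed path from $i$ to $j$ in the graph on $\mathcal S$ with an edge $u\to v$ if and only if $M_{uv}>0$.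 Global and partial extinction probabilities: $q_i=\mathbf P_i(\lim_n|\boldsymbol Z_n|=0)$ and $\tilde q_i=\mathbf P_i(\forall l\ge1:\lim_nZ_{n,l}=0)$; $\boldsymbol q=(q_i)_{i\ge1}$, and $\boldsymbol 1$ is the vector of ones. Given $k\ge1$ and a probability distribution $\boldsymbol\alpha^{(k)}=(\alpha^{(k)}_1,\dots,\alpha^{(k)}_k)$ on $\{1,\dots,k\}$, $\{\bar{\boldsymbol Z}^{(k)}_n\}$ is the branching process in which types in $\{1,\dots,k\}$ have the same progeny distribution as in $\{\boldsymbol Z_n\}$, except that every individual of type larger than $k$ is instantaneously, and independently of everything else, replaced by an individual whose type is drawn from $\boldsymbol\alpha^{(k)}$ and which then reproduces according to the progeny distribution of its new type. Its $k\times k$ mean progeny matrix is $\bar M^{(k)}=\tilde M^{(k)}+\boldsymbol x^{(k)}\boldsymbol\alpha^{(k)}$, where $\tilde M^{(k)}=(M_{ij})_{1\le i,j\le k}$, $\boldsymbol x^{(k)}$ is the $k\times1$ vector with $x^{(k)}_i=\sum_{j>k}M_{ij}$, and $\boldsymbol\alpha^{(k)}$ is a row vector. $\rho(\cdot)$ denotes the Perron–Frobenius eigenvalue.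
   Formalization: The formal theorem also assumes non-singularity: no finite communicating class of types in which every individual almost surely has exactly one child in the class. Without it the claim fails in case (a), e.g. when type 1 always has exactly one child of type 1. *)

(* Defs.v *)
(* Types are the natural numbers, shifted by one: the nat j stands for the type
   j + 1 of S = {1, 2, 3, ...}.  Hence "types in {1, ..., k}" are the j < k,
   and "types larger than k" are the j >= k. *)
From HB Require Import structures.
From mathcomp Require Export all_boot all_order all_algebra.
From mathcomp Require Export finmap multiset.
From mathcomp Require Export all_classical all_reals all_analysis.
From mathcomp Require Export complex.

Set Implicit Arguments.
Unset Strict Implicit.
Unset Printing Implicit Defensive.

Import Order.TTheory GRing.Theory Num.Theory.
Import numFieldNormedType.Exports.

Local Open Scope classical_set_scope.
Local Open Scope ring_scope.
Local Open Scope mset_scope.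

(* A vector (r_1, r_2, ...) of natural numbers with finitely many nonzero
   entries: the multiplicity r j is the number of individuals of type j, and
   size r is the total number of individuals. *)
Notation population := {mset nat}%mset.

Section ProgenyLaw.
Context {R : realType}.
Implicit Type p : nat -> population -> R.

Definition progeny_law p : Prop :=
  (forall i r, 0 <= p i r) /\
  (forall i, \esum_(r in [set: population]) (p i r)%:E = 1%E).

Definition mean_progeny p (i j : nat) : \bar R :=
  \esum_(r in [set: population]) (p i r * (r j)%:R)%:E.

Definition finite_row_sums p : Prop :=
  forall i, (\sum_(0 <= j <oo) mean_progeny p i j < +oo)%E.

(* Directed paths may have length 0. *)
Definition has_path p (i j : nat) : Prop :=
  exists s : seq nat,
    path (fun u v => (0 < mean_progeny p u v)%E) i s /\ last i s = j.

(* A final class (Sevastyanov) is a communicating class of types in which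
   every individual has almost surely exactly one child in the class.  Finitely
   many types with Perron-Frobenius eigenvalue at most 1 die out almost surely
   only when there is no final class. *)
Definition final_class p (C : {fset nat}) : Prop :=
  [/\ exists i, i \in C,
      forall i j, i \in C ->
        (j \in C <-> has_path p i j /\ has_path p j i) &
      forall i r, i \in C -> 0 < p i r -> (\sum_(j <- C) r j)%N = 1%N].

End ProgenyLaw.

Section Process.
Context {R : realType} {d : measure_display} {T : measurableType d}.
Variable P : probability T R.

(* xi n i m is the offspring of the m-th individual of type i in generation n.
   With F a singleton the last clause says that xi n i m has law p i; in
   general it says that the xi n i m are moreover mutually independent. *)
Definition offspring_family (p : nat -> population -> R)
    (xi : nat -> nat -> nat -> T -> population) : Prop :=
  (forall n i m r, measurable [set w | xi n i m w = r]) /\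
  (forall (F : {fset nat * nat * nat}) (r : nat * nat * nat -> population),
     P [set w | forall t, t \in F -> xi t.1.1 t.1.2 t.2 w = r t] =
     (\prod_(t <- F) p t.1.2 (r t))%:E).

(* The process started from one individual of type i0; its law is the
   conditional law given that the initial type is i0. *)
Fixpoint gw (xi : nat -> nat -> nat -> T -> population) (i0 n : nat) (w : T)
    : population :=
  if n is n'.+1 then
    \big[msetD/mset0]_(i <- finsupp (gw xi i0 n' w))
      \big[msetD/mset0]_(m < gw xi i0 n' w i) xi n' i m w
  else [mset i0].

Definition global_ext (xi : nat -> nat -> nat -> T -> population) (i : nat)
    : \bar R :=
  P [set w | (fun n => (size (gw xi i n w))%:R : R) @ \oo --> (0 : R)].

Definition partial_ext (xi : nat -> nat -> nat -> T -> population) (i : nat)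
    : \bar R :=
  P [set w | forall l, (fun n => (gw xi i n w l)%:R : R) @ \oo --> (0 : R)].

End Process.

Section AugmentedMean.
Context {R : realType}.
Implicit Type p : nat -> population -> R.

Definition trunc_mean p (k : nat) : 'M[R]_k :=
  \matrix_(i, j) fine (mean_progeny p i j).

Definition exit_mean p (k : nat) : 'cV[R]_k :=
  \col_i fine (\sum_(k <= j <oo) mean_progeny p i j)%E.

Definition aug_mean p (k : nat) (alpha : 'rV[R]_k) : 'M[R]_k :=
  trunc_mean p k + exit_mean p k *m alpha.

Definition distribution_row (k : nat) (alpha : 'rV[R]_k) : Prop :=
  (forall j, 0 <= alpha ord0 j) /\ \sum_j alpha ord0 j = 1.

(* The matrix need not be irreducible: its Perron-Frobenius eigenvalue is the
   real eigenvalue equal to the spectral radius, taken over C = R[i]. *)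
Definition is_PF_eigenvalue (k : nat) (A : 'M[R]_k) (rho : R) : Prop :=
  eigenvalue A rho /\
  forall z : R[i],
    eigenvalue (map_mx (real_complex R) A) z -> `|z| <= real_complex R rho.

End AugmentedMean.

(* Main.v *)
Require Import Defs.
From HB Require Import structures.
From mathcomp Require Import all_boot all_order all_algebra.
From mathcomp Require Import finmap multiset.
From mathcomp Require Import all_classical all_reals all_analysis.
From mathcomp Require Import measurable_realfun ring lra.

(* Let G be the map of offspring generating functions and q the vector of global
   extinction probabilities, the least fixed point of G.  If y is a vector with
   G y <= y on the first k types, and y_j = 1 or 1 - y_j < alpha . (1 - y) for
   each other type j, the union bound makes 1 - y, restricted to the first k
   types, subinvariant under the augmented mean matrix.  If 1 - y <> 0 there,
   then, since the Perron-Frobenius eigenvalue is at most 1, equality holds on a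
   nonempty closed set of types, and equality in the union bound yields a
   nonempty finite set of types in which every individual has exactly one child.
   A minimal such set would be a final class: if it communicated with an outside
   type, the Perron-Frobenius eigenvalue would exceed 1 for large k.  Hence every
   such y is 1 on the first k types.
   Taking y = 0 where q = 0 and y = 1 elsewhere gives q > 0, so q >= c > 0.  If
   q <> 1, both alternatives on the first N1 types give q_j < 1 there.  The roots
   g = q^(2^-m) satisfy G g <= g by Cauchy-Schwarz and are uniformly close to 1,
   whereas G^n g tends to q, since E[q^Z_n; Z_n <> 0] tends to 0.  Iterating G on
   the first k types only, starting from g, gives a forbidden y for large k. *)

Set Implicit Arguments.
Unset Strict Implicit.
Unset Printing Implicit Defensive.

Import Order.TTheory GRing.Theory Num.Theory.
Import numFieldNormedType.Exports.

Local Open Scope classical_set_scope.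
Local Open Scope ring_scope.

(** * Nonnegative matrices without eigenvalue above 1 *)

Lemma finite_pos_lower_bound (R : realFieldType) (I : finType) (f : I -> R) :
  (forall i, 0 < f i) -> exists2 d, 0 < d & forall i, d < f i.
Proof.
(* This reciprocal lies strictly below every [f i], and it exists also for empty [I], where there is
   no minimum. *)
move=> f0; exists ((\sum_i (f i)^-1 + 1)^-1).
  by rewrite invr_gt0 ltr_wpDl// sumr_ge0// => i _; rewrite invr_ge0 ltW.
move=> i; rewrite -[ltRHS]invrK ltf_pV2 ?posrE ?invr_gt0//; last first.
  by rewrite ltr_wpDl// sumr_ge0// => j _; rewrite invr_ge0 ltW.
rewrite (bigD1 i)//= -addrA ltrDl ltr_wpDl// sumr_ge0// => j _.
by rewrite invr_ge0 ltW.
Qed.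

Section NonnegativeMatrix.
Context {R : realType} {k : nat}.
Implicit Types (A : 'M[R]_k) (u v w e : 'cV[R]_k) (x : R).

(* For nonnegative A this says that x exceeds the spectral radius of A. *)
Definition superradius A x : Prop := exists e : 'cV[R]_k,
  forall i, 0 < e i 0 /\ (A *m e) i 0 < x * e i 0.

Lemma mulmx_mono A u v : (forall i j, 0 <= A i j) ->
  (forall i, u i 0 <= v i 0) -> forall i, (A *m u) i 0 <= (A *m v) i 0.
Proof. by move=> A0 uv i; rewrite !mxE ler_sum// => j _; rewrite ler_wpM2l. Qed.

Lemma mulmx_ge0 A v : (forall i j, 0 <= A i j) ->
  (forall i, 0 <= v i 0) -> forall i, 0 <= (A *m v) i 0.
Proof. by move=> A0 v0 i; rewrite mxE sumr_ge0// => j _; rewrite mulr_ge0. Qed.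

(** A minimum principle. If u were negative somewhere, let i minimize u / e, with minimum t < 0.
    Then u >= t e gives A u >= t (A e), which at i exceeds t x e = x u, contrary to the
    hypothesis. *)
Lemma superradius_mono A x u : (forall i j, 0 <= A i j) -> superradius A x ->
  (forall i, (A *m u) i 0 <= x * u i 0) -> forall i, 0 <= u i 0.
Proof.
move=> A0 [e He] Hu i0; rewrite leNgt; apply/negP => ui0.
case: (@arg_minP _ _ _ i0 xpredT (fun j => u j 0 / e j 0)) => // i _ Hi.
set t := u i 0 / e i 0 in Hi.
have [ei ?] := He i.
have t0 : t < 0.
  by apply: le_lt_trans (Hi i0 isT) _; rewrite pmulr_llt0// invr_gt0 (He i0).1.
have ue j : t * e j 0 <= u j 0.
  by rewrite -ler_pdivlMr ?(He j).1// Hi.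
have h1 : t * (A *m e) i 0 <= (A *m u) i 0.
  rewrite !mxE mulr_sumr ler_sum// => j _.
  by rewrite mulrCA ler_wpM2l.
have ute : u i 0 = t * e i 0 by rewrite /t divfK// gt_eqF.
have := Hu i; rewrite ute; nra.
Qed.

Lemma superradius_le A x x' : superradius A x -> x <= x' -> superradius A x'.
Proof.
move=> [e He] xx'; exists e => i; have [e0 ?] := He i; split=> //.
by apply: lt_le_trans (_ : _ < x * e i 0) _ => //; rewrite ler_wpM2r// ltW.
Qed.

Lemma superradius_large A : (forall i j, 0 <= A i j) ->
  superradius A (1 + \sum_i \sum_j A i j).
Proof.
move=> A0; exists (const_mx 1) => i; rewrite !mxE; split => //.
under eq_bigr do rewrite mxE mulr1.
by rewrite mulr1 ltr_pwDl// [leRHS](bigD1 i)//= lerDl sumr_ge0// => j _; rewrite sumr_ge0.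
Qed.

(** Finitely many strict inequalities leave a common slack relative to e. *)
Lemma superradius_open A x : superradius A x ->
  exists2 d, 0 < d & superradius A (x - d).
Proof.
move=> [e He].
have [|d d0 Hd] := @finite_pos_lower_bound R _
    (fun i => (x * e i 0 - (A *m e) i 0) / e i 0).
  by move=> i; rewrite divr_gt0 ?(He i).1// subr_gt0 (He i).2.
exists d => //; exists e => i; have [ei ?] := He i; split=> //.
by have := Hd i; rewrite ltr_pdivlMr//; lra.
Qed.

Lemma superradius_closed A x : (forall i j, 0 <= A i j) -> 0 < x ->
  ~~ eigenvalue A x -> (forall x', x < x' -> superradius A x') ->
  superradius A x.
Proof.
move=> A0 x0; rewrite negbK kermx_eq0 row_free_unit => unitA Hx.
(* e = (x - A)^-1 1, and monotonicity just above x makes e nonnegative. *)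
pose e : 'cV[R]_k := - (invmx (A - x%:M) *m const_mx 1).
have Ae i : (A *m e) i 0 = x * e i 0 - 1.
  have : (A - x%:M) *m e = - const_mx 1 by rewrite mulmxN mulKVmx.
  by move/matrixP/(_ i 0); rewrite mulmxBl mul_scalar_mx !mxE; lra.
have e_ge0 i : 0 <= e i 0.
  (* With d |e j| < 1 for all j, the equation A e = x e - 1 gives A e <= (x + d) e, and x + d is a
     superradius. *)
  have [|d d0 Hd] := @finite_pos_lower_bound R _ (fun i => (1 + `|e i 0|)^-1).
    by move=> j; rewrite invr_gt0 ltr_pwDl.
  apply: (superradius_mono A0 (Hx (x + d) _)); first by rewrite ltrDl.
  move=> j; have := Hd j; rewrite Ae -[(1 + _)^-1]mul1r ltr_pdivlMr ?ltr_pwDl//.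
  have := ler_norm (- e j 0); rewrite normrN; nra.
exists e => i; have Aei := Ae i.
have := mulmx_ge0 A0 e_ge0 i; rewrite Aei; split; last by lra.
by rewrite -(pmulr_rgt0 _ x0); lra.
Qed.

(** The superradii from l upwards form an up-closed set. Its infimum belongs to it by closedness, as
    no eigenvalue is met, and by openness the infimum cannot lie above l. *)
Lemma superradius_gt A (l : R) : (forall i j, 0 <= A i j) -> 0 < l ->
  (forall x, l <= x -> ~~ eigenvalue A x) -> superradius A l.
Proof.
move=> A0 l0 Hl; pose E := [set x | l <= x /\ superradius A x]%classic.
have E_inf : has_inf E.
  split; last by exists l => x [].
  exists (Num.max l (1 + \sum_i \sum_j A i j)); split; first by rewrite le_max lexx.
  by apply: superradius_le (superradius_large A0) _; rewrite le_max lexx orbT.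
have lE : l <= inf E by apply: lb_le_inf; [exact: E_inf.1|move=> x []].
have aboveE x : inf E < x -> superradius A x.
  by move=> /(inf_lt E_inf.1)[y [ly Ay] /ltW]; exact: superradius_le.
have infE : superradius A (inf E).
  apply: superradius_closed => //; first exact: lt_le_trans lE.
  exact: Hl.
have [->//|ltE] := eqVneq l (inf E).
have {}ltE : l < inf E by rewrite lt_neqAle ltE.
have [d d0 Ad] := superradius_open infE.
have [ld|dl] := leP l (inf E - d); last by apply: superradius_le Ad (ltW dl).
have : inf E <= inf E - d by apply: ge_inf => //; exact: E_inf.2.
by rewrite leNgt ltrBlDr ltrDl d0.
Qed.

(** For nonnegative A this is equivalent, by Perron-Frobenius, to spectral radius at most 1, but it
    mentions real eigenvalues only. *)
Definition no_eigenvalue_gt1 A := forall x, 1 < x -> ~~ eigenvalue A x.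

(** Here l is a superradius, and monotonicity applied to -w gives w <= 0. *)
Lemma no_expanding_vector A w l : (forall i j, 0 <= A i j) ->
  no_eigenvalue_gt1 A -> 1 < l -> (forall i, 0 <= w i 0) ->
  (forall i, l * w i 0 <= (A *m w) i 0) -> forall i, w i 0 = 0.
Proof.
move=> A0 HA l1 w0 Hw i; apply/eqP; rewrite eq_le w0 andbT -oppr_ge0.
suff : 0 <= (- w) i 0 by rewrite mxE.
apply: (superradius_mono A0 (@superradius_gt A l A0 _ _)).
- by apply: lt_trans l1.
- by move=> x lx; apply: HA; exact: lt_le_trans lx.
- by move=> j; rewrite mulmxN [(- (A *m w)) j 0]mxE [(- w) j 0]mxE mulrN lerN2.
Qed.

(** A may be reducible, so equality cannot be expected on the whole support of v. It is obtained on
    a nonempty part of the support that is closed under the edges of A leading back into the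
    support. *)
Lemma subinvariant_equality A v : (forall i j, 0 <= A i j) ->
  no_eigenvalue_gt1 A -> (forall i, 0 <= v i 0) ->
  (forall i, v i 0 <= (A *m v) i 0) -> (exists i, 0 < v i 0) ->
  exists C : {set 'I_k}, [/\ exists i, i \in C,
    forall i, i \in C -> 0 < v i 0 /\ (A *m v) i 0 = v i 0 &
    forall i j, i \in C -> 0 < A i j -> 0 < v j 0 -> j \in C].
Proof.
move=> A0 HA v0 Av [i0 vi0].
(* C collects the types at which no iterate of the defect D is positive.  If
   there is none, w = sum_(m < N) A^m v satisfies A w > w on its support. *)
pose D : 'cV[R]_k := A *m v - v.
pose P m (u : 'cV[R]_k) : 'cV[R]_k := iter m (mulmx A) u.
have P0 m u : (forall i, 0 <= u i 0) -> forall i, 0 <= P m u i 0.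
  by move=> u0; elim: m => [|m IH]//= i; exact: mulmx_ge0.
have D0 i : 0 <= D i 0 by have := Av i; rewrite [D i 0]mxE [(- v) i 0]mxE subr_ge0.
pose C := [set i | (0 < v i 0) && `[< forall m, P m D i 0 = 0 >]]%SET.
have [/existsP[i iC]|noC] := boolP [exists i, i \in C].
  exists C; split; first by exists i.
    move=> j; rewrite inE => /andP[vj /asboolP/(_ 0)/=].
    by rewrite [D _ _]mxE [(- v) _ _]mxE => /eqP; rewrite subr_eq0 => /eqP.
  move=> j l; rewrite inE => /andP[vj /asboolP Pj] Ajl vl.
  rewrite inE vl; apply/asboolP => m.
  have := Pj m.+1; rewrite /= mxE => /eqP; rewrite psumr_eq0; last first.
    by move=> l' _; rewrite mulr_ge0 ?P0.
  by move=> /allP/(_ l (mem_index_enum _)) /=; rewrite mulf_eq0 (gt_eqF Ajl)/= => /eqP.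
exfalso.
have /choice[f Hf] : forall i, exists m, 0 < v i 0 -> 0 < P m D i 0.
  move=> i; have [vi|] := ltP 0 (v i 0); last by exists 0%N.
  apply: contrapT => Hn; move/negP: noC; apply; apply/existsP; exists i.
  rewrite inE vi; apply/asboolP => m; apply/eqP; rewrite eq_le P0// andbT leNgt.
  by apply/negP => Pm; apply: Hn; exists m.
(* N exceeds every [f i], so that z has a positive term wherever v is positive. *)
pose N := (\max_i f i).+1.
pose w : 'cV_k := \sum_(m < N) P m v.
pose z : 'cV_k := \sum_(m < N) P m D.
have PB m u u' : P m (u - u') = P m u - P m u'.
  by elim: m => //= m ->; rewrite mulmxBr.
have PA m u : P m (A *m u) = P m.+1 u by rewrite /P -iterSr.
have Aw : A *m w = w + z.
  rewrite /w /z -big_split/= mulmx_sumr; apply: eq_bigr => m _.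
  by rewrite /D PB PA addrC subrK.
have w0 i : 0 <= w i 0 by rewrite summxE sumr_ge0// => m _; exact: P0.
have z0 i : 0 <= z i 0 by rewrite summxE sumr_ge0// => m _; exact: P0.
have Pz m i : (m < N)%N -> P m D i 0 <= z i 0.
  move=> mN; rewrite summxE (bigD1 (Ordinal mN))//= lerDl sumr_ge0// => j _.
  exact: P0.
have zpos i : 0 < w i 0 -> 0 < z i 0.
  have [vi _|vi wi] := ltP 0 (v i 0).
    by apply: lt_le_trans (Hf _ vi) _; apply: Pz; rewrite ltnS leq_bigmax.
  (* If z vanishes at i, so do the increments A^m D = A^(m+1) v - A^m v for m < N. Then A^m v stays
     at its initial value 0 there, and w vanishes at i. *)
  rewrite lt_neqAle z0 andbT; apply/negP => /eqP zi.
  have Pm m : (m <= N)%N -> P m v i 0 = 0.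
    elim: m => [_|m IH mN]; first by apply/eqP; rewrite eq_le vi v0.
    have := Pz m i mN; rewrite -zi /D PB PA.
    rewrite [X in X <= _]mxE [X in _ + X <= _]mxE (IH (ltnW mN)) subr0 => H.
    by apply/eqP; rewrite eq_le H P0.
  by move: wi; rewrite summxE big1 ?ltxx// => m _; rewrite Pm// ltnW.
(* Where w vanishes nothing is required of d, and 1 is a placeholder. *)
have [|d d0 Hd] := @finite_pos_lower_bound R _
    (fun i => if w i 0 == 0 then 1 else z i 0 / w i 0).
  move=> i; case: eqVneq => // wi.
  have {}wi : 0 < w i 0 by rewrite lt_def wi w0.
  by rewrite divr_gt0// zpos.
have := @no_expanding_vector A w (1 + d) A0 HA _ w0 _ i0.
rewrite ltrDl d0 => H.
suff : w i0 0 = 0.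
  apply/eqP; rewrite gt_eqF// summxE (bigD1 ord0)//= ltr_wpDr// sumr_ge0// => m _.
  exact: P0.
apply: H => // i; rewrite Aw mulrDl mul1r [leRHS]mxE lerD2l.
have := Hd i; case: eqVneq => [->|wi]; first by rewrite mulr0.
have {}wi : 0 < w i 0 by rewrite lt_def wi w0.
by rewrite ltr_pdivlMr// => /ltW.
Qed.

End NonnegativeMatrix.

(** * Expectations and generating functions *)

Lemma esumZl (R : realType) (I : choiceType) (S : set I) (c : R)
    (f : I -> \bar R) : 0 <= c -> (forall i, 0 <= f i)%E ->
  (\esum_(i in S) (c%:E * f i) = c%:E * \esum_(i in S) f i)%E.
Proof.
move=> c0 f0; rewrite /esum -ereal_supZl//; last first.
  by apply/set0P; exists (\sum_(i \in set0) f i)%E, set0 => //; exact: fsets_set0.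
congr ereal_sup; apply/seteqP; split=> [_ [X XS <-]|_ [_ [X XS <-] <-]].
  by exists (\sum_(i \in X) f i)%E; [exists X|rewrite ge0_mule_fsumr].
by exists X => //; rewrite ge0_mule_fsumr.
Qed.

Lemma esum_eq0 (R : realType) (I : choiceType) (f : I -> \bar R) :
  (forall i, 0 <= f i)%E -> (\esum_(i in [set: I]) f i = 0)%E ->
  forall i, f i = 0%E.
Proof.
move=> f0 f00 i; apply/eqP; rewrite eq_le f0 andbT -f00.
apply: esum_ge; exists [set i]; first by split=> //; exact: finite_set1.
by rewrite fsbig_set1.
Qed.

Section CvgSeq.
Context {R : realType} {I : Type}.
Variables (f : nat -> I -> R) (h : I -> R) (l : seq I).
Hypothesis fh : forall i, f^~ i @ \oo --> h i.

Lemma cvg_sum_seq : (fun n => \sum_(i <- l) f n i) @ \oo --> \sum_(i <- l) h i.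
Proof.
elim: l => [|i s IH].
  rewrite big_nil (_ : (fun n => _) = cst 0); first exact: cvg_cst.
  by apply/funext => n; rewrite big_nil.
rewrite big_cons (_ : (fun n => _) = (fun n => f n i + \sum_(j <- s) f n j)).
  exact: cvgD.
by apply/funext => n; rewrite big_cons.
Qed.

Lemma cvg_prod_seq : (fun n => \prod_(i <- l) f n i) @ \oo --> \prod_(i <- l) h i.
Proof.
elim: l => [|i s IH].
  rewrite big_nil (_ : (fun n => _) = cst 1); first exact: cvg_cst.
  by apply/funext => n; rewrite big_nil.
rewrite big_cons (_ : (fun n => _) = (fun n => f n i * \prod_(j <- s) f n j)).
  exact: cvgM.
by apply/funext => n; rewrite big_cons.
Qed.

End CvgSeq.

Section Expectation.
Context {R : realType} {I : choiceType}.
Implicit Types (mu f g : I -> R).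

Definition mass_function mu : Prop :=
  (forall r, 0 <= mu r) /\ (\esum_(r in [set: I]) (mu r)%:E = 1)%E.

Definition expect mu f : \bar R := (\esum_(r in [set: I]) (mu r * f r)%:E)%E.

(** An infinite expectation is sent to 0; the value is meaningful for bounded nonnegative functions,
    through [meanE]. *)
Definition mean mu f : R := fine (expect mu f).

Variable mu : I -> R.
Hypothesis mu_pmf : mass_function mu.
Let mu0 : forall r, 0 <= mu r := mu_pmf.1.

Lemma eq_expect f g : f =1 g -> expect mu f = expect mu g.
Proof. by move=> fg; apply: eq_esum => r _; rewrite fg. Qed.

Lemma expect_ge0 f : (forall r, 0 <= f r) -> (0 <= expect mu f)%E.
Proof. by move=> f0; apply: esum_ge0 => r _; rewrite lee_fin mulr_ge0. Qed.

Lemma expect_le f g : (forall r, f r <= g r) -> (expect mu f <= expect mu g)%E.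
Proof. by move=> fg; apply: le_esum => r _; rewrite lee_fin ler_wpM2l. Qed.

Lemma expectD f g : (forall r, 0 <= f r) -> (forall r, 0 <= g r) ->
  (expect mu (fun r => f r + g r)%R = expect mu f + expect mu g)%E.
Proof.
move=> f0 g0; rewrite /expect -esumD.
- by apply: eq_esum => r _; rewrite mulrDr EFinD.
- by move=> r _; rewrite lee_fin mulr_ge0.
- by move=> r _; rewrite lee_fin mulr_ge0.
Qed.

Lemma expectZ c f : 0 <= c -> (forall r, 0 <= f r) ->
  (expect mu (fun r => c * f r)%R = c%:E * expect mu f)%E.
Proof.
move=> c0 f0; rewrite /expect -esumZl//.
  by apply: eq_esum => r _; rewrite mulrCA EFinM.
by move=> r; rewrite lee_fin mulr_ge0.
Qed.

Lemma expect_cst c : 0 <= c -> expect mu (fun=> c) = c%:E.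
Proof.
move=> c0; transitivity (expect mu (fun=> c * 1)).
  by apply: eq_expect => r; rewrite mulr1.
rewrite expectZ// /expect; under eq_esum do rewrite mulr1.
by rewrite mu_pmf.2 mule1.
Qed.

Lemma expect_fin f c : (forall r, 0 <= f r <= c) -> expect mu f \is a fin_num.
Proof.
move=> fc; rewrite ge0_fin_numE; last by apply: expect_ge0 => r; have /andP[] := fc r.
have [r|noI] := pselect (exists r : I, true).
  have c0 : 0 <= c by case: r => r _; have /andP[] := fc r; exact: le_trans.
  apply: (@le_lt_trans _ _ c%:E); last exact: ltry.
  rewrite -expect_cst//; apply: expect_le => i; by have /andP[] := fc i.
rewrite /expect esum1 ?ltry// => r _; by exfalso; apply: noI; exists r.
Qed.

Lemma meanE f c : (forall r, 0 <= f r <= c) -> (mean mu f)%:E = expect mu f.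
Proof. by move=> fc; rewrite /mean fineK// (expect_fin fc). Qed.

(** The nonnegative difference g - f has expectation 0; finiteness makes the cancellation
    legitimate. *)
Lemma expect_eq f g : (forall r, 0 <= f r) -> (forall r, f r <= g r) ->
  expect mu f \is a fin_num -> expect mu f = expect mu g ->
  forall r, 0 < mu r -> f r = g r.
Proof.
move=> f0 fg ffin fgE r mur.
have gE : expect mu g = (expect mu f + expect mu (fun r => g r - f r)%R)%E.
  rewrite -expectD//; last by move=> i; rewrite subr_ge0.
  by apply: eq_expect => i; rewrite addrC subrK.
have d0 : expect mu (fun r => g r - f r) = 0%E.
  move: gE; rewrite -fgE; case: (expect mu f) ffin => // a _.
  by case: (expect _ _) => [b|//|//] [ab]; congr EFin; lra.
have := esum_eq0 _ d0 r.
move=> /(_ _)/eqP; rewrite eqe mulf_eq0 gt_eqF//= subr_eq0 => H.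
apply/esym/eqP/H => i; by rewrite lee_fin mulr_ge0// subr_ge0.
Qed.

Lemma mean_le f g c : (forall r, 0 <= f r) -> (forall r, f r <= g r) ->
  (forall r, g r <= c) -> mean mu f <= mean mu g.
Proof.
move=> f0 fg gc; rewrite -lee_fin (@meanE f c) ?(@meanE g c).
- exact: expect_le.
- by move=> r; rewrite gc (le_trans (f0 r)).
- by move=> r; rewrite f0 (le_trans (fg r)).
Qed.

Lemma mean_cst c : 0 <= c -> mean mu (fun=> c) = c.
Proof. by move=> c0; rewrite /mean expect_cst. Qed.

Lemma mean_bound f c : 0 <= c -> (forall r, 0 <= f r <= c) -> 0 <= mean mu f <= c.
Proof.
move=> c0 fc; rewrite -!lee_fin (meanE fc) expect_ge0/=; last first.
  by move=> r; have /andP[] := fc r.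
by rewrite -(expect_cst c0); apply: expect_le => r; have /andP[] := fc r.
Qed.

Lemma meanD f g c : (forall r, 0 <= f r <= c) -> (forall r, 0 <= g r <= c) ->
  mean mu (fun r => f r + g r) = mean mu f + mean mu g.
Proof.
move=> fc gc; apply: EFin_inj; rewrite EFinD (meanE fc) (meanE gc) -expectD.
- apply: (@meanE _ (c + c)) => r; have /andP[? ?] := fc r; have /andP[? ?] := gc r.
  by rewrite addr_ge0//= lerD.
- by move=> r; have /andP[] := fc r.
- by move=> r; have /andP[] := gc r.
Qed.

Lemma meanZ a f c : 0 <= a -> (forall r, 0 <= f r <= c) ->
  mean mu (fun r => a * f r) = a * mean mu f.
Proof.
move=> a0 fc; apply: EFin_inj; rewrite EFinM (meanE fc) -expectZ//.
  apply: (@meanE _ (a * c)) => r; have /andP[? ?] := fc r.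
  by rewrite mulr_ge0//= ler_wpM2l.
by move=> r; have /andP[] := fc r.
Qed.

(** Cauchy-Schwarz against the constant 1, by taking the mean of 2 m f <= f^2 + m^2. *)
Lemma sqr_mean_le f : (forall r, 0 <= f r <= 1) ->
  mean mu f ^+ 2 <= mean mu (fun r => f r ^+ 2).
Proof.
move=> f01; set m := mean mu f.
have /andP[m0 m1] : 0 <= m <= 1 by apply: mean_bound.
have f2 r : 0 <= f r ^+ 2 <= 1.
  by have /andP[? ?] := f01 r; rewrite exprn_ge0//= exprn_ile1.
have : mean mu (fun r => (2 * m) * f r) <= mean mu (fun r => f r ^+ 2 + m ^+ 2).
  apply: (@mean_le _ _ 2) => r; have /andP[? ?] := f01 r; have /andP[? ?] := f2 r.
  - by rewrite !mulr_ge0.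
  - by have := sqr_ge0 (f r - m); rewrite !expr2; lra.
  - by have : m ^+ 2 <= 1 by [exact: exprn_ile1]; lra.
rewrite (@meanZ _ _ 1)//; last by rewrite mulr_ge0.
rewrite (@meanD _ _ 1)//; last by move=> r; rewrite exprn_ge0//= exprn_ile1.
rewrite mean_cst ?exprn_ge0// -/m; nra.
Qed.

(** Fatou: a finite set carries the mean of h up to e / 2, and on it the convergence is that of a
    finite sum. *)
Lemma mean_lower_semicontinuous (f : nat -> I -> R) (h : I -> R) :
  (forall n r, 0 <= f n r <= 1) -> (forall r, 0 <= h r <= 1) ->
  (forall r, f^~ r @ \oo --> h r) ->
  forall e, 0 < e -> \forall n \near \oo, mean mu h - e <= mean mu (f n).
Proof.
move=> f01 h01 fh e e0.
have /= : ((mean mu h - e / 2)%:E < expect mu h)%E.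
  by rewrite -(meanE h01) lte_fin; lra.
rewrite /expect /esum => /ereal_sup_gt[_ [X [finX _] <-]].
rewrite fsumEFin// lte_fin => hX.
have cvgX : (fun n => \sum_(r \in X) mu r * f n r) @ \oo -->
    \sum_(r \in X) mu r * h r.
  rewrite fsbig_finite//; under eq_fun do rewrite fsbig_finite//.
  by apply: cvg_sum_seq => r; apply: cvgM => //; exact: cvg_cst.
have e2 : 0 < e / 2 by lra.
move/cvgrPdist_lt: cvgX => /(_ _ e2).
apply: filterS => n /(le_lt_trans (ler_norm _)) Hn.
suff : \sum_(r \in X) mu r * f n r <= mean mu (f n) by lra.
rewrite -lee_fin (meanE (f01 n)) -fsumEFin//.
by apply: ereal_sup_ubound; exists X.
Qed.

(** Bounded convergence: lower semicontinuity is applied to f and to 1 - f. *)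
Lemma cvg_mean (f : nat -> I -> R) (h : I -> R) :
  (forall n r, 0 <= f n r <= 1) -> (forall r, 0 <= h r <= 1) ->
  (forall r, f^~ r @ \oo --> h r) -> (fun n => mean mu (f n)) @ \oo --> mean mu h.
Proof.
move=> f01 h01 fh; apply/cvgrPdist_le => e e0.
have compl (g : I -> R) : (forall r, 0 <= g r <= 1) ->
    (forall r, 0 <= 1 - g r <= 1) /\ mean mu (fun r => 1 - g r) = 1 - mean mu g.
  move=> g01; have g01' r : 0 <= 1 - g r <= 1.
    by have /andP[? ?] := g01 r; apply/andP; split; lra.
  split=> //; have := @meanD _ _ 1 g01 g01'.
  under [X in mean mu X]eq_fun do rewrite addrC subrK.
  by rewrite mean_cst//; lra.
have /= := @mean_lower_semicontinuous _ _ f01 h01 fh e e0.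
have /= := @mean_lower_semicontinuous (fun n r => 1 - f n r) (fun r => 1 - h r)
  (fun n => (compl _ (f01 n)).1) (compl _ h01).1 _ e e0.
move=> /(_ _)H1; apply: filterS2 (H1 _) => [n|r].
  rewrite !(compl _ _).2// ler_norml => ? ?; apply/andP; split; lra.
by apply: cvgB => //; exact: cvg_cst.
Qed.

End Expectation.

(** * The union bound for products and its equality case *)

Section ProductBound.
Context {R : realFieldType}.
Definition unit_valued (s : nat -> R) : Prop := forall j, 0 <= s j <= 1.

Variable y : nat -> R.
Hypothesis y01 : unit_valued y.

Lemma prod_unit_valued (l : seq nat) : 0 <= \prod_(x <- l) y x <= 1.
Proof.
elim/big_rec: _ => [|j x _ /andP[? ?]]; first by rewrite ler01 lexx.
by have /andP[? ?] := y01 j; rewrite mulr_ge0//= mulr_ile1.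
Qed.

Lemma one_le_prod_sum (l : seq nat) :
  1 <= \prod_(x <- l) y x + \sum_(x <- l) (1 - y x).
Proof.
elim: l => [|x l IH]; first by rewrite !big_nil addr0.
rewrite !big_cons; have /andP[? ?] := y01 x; have := prod_unit_valued l; nra.
Qed.

(** Two factors below 1 would make the union bound strict: if y x < 1 and the remaining product is
    Y, equality leaves (1 - y x) (1 - Y) <= 0, hence Y = 1. *)
Lemma one_eq_prod_sum (l : seq nat) :
  \prod_(x <- l) y x + \sum_(x <- l) (1 - y x) = 1 ->
  (forall x, x \in l -> y x = 1) \/
  exists x l', [/\ perm_eq l (x :: l'), y x < 1 & forall z, z \in l' -> y z = 1].
Proof.
elim: l => [|x l IH]; first by left.
rewrite !big_cons => E; have /andP[y0 y1] := y01 x.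
have /andP[Y0 Y1] := prod_unit_valued l; have := one_le_prod_sum l => L.
have [yx|yx] := ltP (y x) 1.
  right; exists x, l; split=> // z zl.
  have Y1' : \prod_(x <- l) y x = 1.
    apply/eqP; rewrite eq_le Y1/= leNgt; apply/negP => Ylt.
    have : 0 < (1 - y x) * (1 - \prod_(x <- l) y x) by rewrite mulr_gt0// subr_gt0.
    rewrite mulrBl mul1r mulrBr mulr1; lra.
  have S0 : \sum_(x <- l) (1 - y x) = 0 by move: E; rewrite Y1' mulr1; lra.
  move/eqP: S0; rewrite psumr_eq0 => [/allP/(_ z zl)/=|i _].
    by rewrite subr_eq0 => /eqP ->.
  by rewrite subr_ge0; have /andP[] := y01 i.
have {}yx : y x = 1 by apply/eqP; rewrite eq_le y1.
rewrite yx mul1r subrr add0r in E.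
have [H|[x0 [l' [pl yx0 Hl']]]] := IH E.
  by left=> z; rewrite inE => /orP[/eqP->|/H].
right; exists x0, (x :: l'); split=> //; last first.
  by move=> z; rewrite inE => /orP[/eqP->|/Hl'].
apply: (@perm_trans _ (x :: x0 :: l')); first by rewrite perm_cons.
by rewrite (perm_catCA [:: x] [:: x0] l').
Qed.

End ProductBound.

Section GeneratingFunction.
Context {R : realType}.
Implicit Types (mu : population -> R) (s : nat -> R) (r : population).

Definition monomial s r : R := \prod_(j <- r) s j.

Definition pgf mu s : R := mean mu (monomial s).

Lemma monomial01 s : unit_valued s -> forall r, 0 <= monomial s r <= 1.
Proof.
by move=> s01 r; exact: prod_unit_valued.
Qed.

Lemma monomial_le s t : (forall j, 0 <= s j <= t j) -> forall r,
  monomial s r <= monomial t r.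
Proof. by move=> st r; rewrite /monomial ler_prod. Qed.

Lemma monomial_le_at s r j : unit_valued s -> (0 < r j)%N -> monomial s r <= s j.
Proof.
move=> s01; rewrite -in_mset /monomial => jr.
rewrite (perm_big _ (perm_to_rem jr)) big_cons ler_piMr//.
  by have /andP[] := s01 j.
elim/big_rec: _ => // i x _ x1; have /andP[? ?] := s01 i.
have [x0|x0] := leP 0 x; first exact: mulr_ile1.
by apply: le_trans ler01; rewrite mulr_ge0_le0// ltW.
Qed.

Lemma monomial_cst0 r : monomial (fun=> 0) r = (r == mset0)%:R.
Proof.
have [->|r0] := eqVneq r mset0; first by rewrite /monomial big_mset0.
suff [j jr] : exists j, (0 < r j)%N.
  apply/eqP; rewrite eq_le; apply/andP; split.
    by apply: le_trans (monomial_le_at _ jr) _ => // j'; rewrite lexx ler01.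
  by have /andP[] := @monomial01 (fun=> 0) (fun=> ltac:(by rewrite lexx ler01)) r.
apply: contrapT => H; move/eqP: r0; apply; apply/msetP => j.
by rewrite mset0E; apply/eqP; rewrite -leqn0 leqNgt; apply/negP => ?; apply: H; exists j.
Qed.

Variable mu : population -> R.
Hypothesis mu_pmf : mass_function mu.

Lemma pgf01 s : unit_valued s -> 0 <= pgf mu s <= 1.
Proof. by move=> s01; apply: mean_bound => //; exact: monomial01. Qed.

Lemma pgf_le s t : (forall j, 0 <= s j <= t j) -> unit_valued t ->
  pgf mu s <= pgf mu t.
Proof.
move=> st t01; apply: (@mean_le _ _ _ _ _ _ 1) => // r.
- by rewrite prodr_ge0// => j _; have /andP[] := st j.
- exact: monomial_le.
- by have /andP[] := monomial01 t01 r.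
Qed.

Lemma pgf0 : pgf mu (fun=> 0) = mu mset0.
Proof.
rewrite /pgf /mean /expect -(setUv [set mset0 : population]).
rewrite (_ : esum _ _ = (mu mset0)%:E)//.
rewrite (esumID [set mset0]); last first.
  by move=> r _; rewrite lee_fin mulr_ge0 ?(mu_pmf.1)// monomial_cst0.
rewrite setUv !setTI esum_set1; last first.
  by rewrite lee_fin mulr_ge0 ?(mu_pmf.1)// monomial_cst0.
rewrite esum1 ?adde0 ?monomial_cst0 ?eqxx ?mulr1// => r /= /eqP/negPf r0.
by rewrite monomial_cst0 r0 mulr0.
Qed.

Lemma cvg_pgf (s : nat -> nat -> R) t : (forall n, unit_valued (s n)) ->
  unit_valued t -> (forall j, s^~ j @ \oo --> t j) ->
  (fun n => pgf mu (s n)) @ \oo --> pgf mu t.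
Proof.
move=> s01 t01 st; apply: cvg_mean => // [n r|r|r]; [exact: monomial01..|exact: cvg_prod_seq].
Qed.

Lemma sqrt_unit_valued s : unit_valued s -> unit_valued (fun j => Num.sqrt (s j)).
Proof.
move=> s01 j; have /andP[? s1] := s01 j.
by rewrite sqrtr_ge0 -[leRHS]sqrtr1 ler_wsqrtr.
Qed.

Lemma monomial_sqrt s r : unit_valued s ->
  monomial (fun j => Num.sqrt (s j)) r ^+ 2 = monomial s r.
Proof.
move=> s01; rewrite /monomial -prodrXl; apply: eq_bigr => j _.
by rewrite sqr_sqrtr//; have /andP[] := s01 j.
Qed.

(** Cauchy-Schwarz for the monomial of the square roots, whose square is the monomial of s. *)
Lemma pgf_sqrt s : unit_valued s ->
  pgf mu (fun j => Num.sqrt (s j)) ^+ 2 <= pgf mu s.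
Proof.
move=> s01; have m01 := monomial01 (sqrt_unit_valued s01).
rewrite /pgf (le_trans (sqr_mean_le mu_pmf m01))//.
rewrite le_eqVlt; apply/orP; left; apply/eqP; congr (mean mu _).
by apply/funext => r; rewrite monomial_sqrt.
Qed.

(** The difference is E[s^Z; Z <> 0], again the mean of a function with values in [0, 1], so
    Cauchy-Schwarz applies to it too. *)
Lemma pgf_sub0 s : unit_valued s ->
  pgf mu s - mu mset0 = mean mu (fun r => monomial s r - (r == mset0)%:R) /\
  forall r, 0 <= monomial s r - (r == mset0)%:R <= 1.
Proof.
move=> s01; have d01 r : 0 <= monomial s r - (r == mset0)%:R <= 1.
  have [->|_] := eqVneq r mset0; last by rewrite subr0 monomial01.
  by rewrite /monomial big_mset0 subrr lexx ler01.
split=> //; rewrite -pgf0 /pgf.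
rewrite (_ : monomial (fun=> 0) = fun r => (r == mset0)%:R); last first.
  by apply/funext => r; rewrite monomial_cst0.
have := @meanD _ _ _ mu_pmf _ (fun r : population => (r == mset0)%:R) _ d01.
have -> : (fun r => monomial s r - (r == mset0)%:R + (r == mset0)%:R) = monomial s.
  by apply/funext => r; rewrite subrK.
by move=> ->; [rewrite addrK|move=> r; case: eqP; rewrite lexx ?ler01].
Qed.

Lemma pgf_sqrt_sub0 s : unit_valued s ->
  (pgf mu (fun j => Num.sqrt (s j)) - mu mset0) ^+ 2 <= pgf mu s - mu mset0.
Proof.
move=> s01; have [-> _] := pgf_sub0 s01.
have [-> m01] := pgf_sub0 (sqrt_unit_valued s01).
apply: le_trans (sqr_mean_le mu_pmf m01) _.
rewrite le_eqVlt; apply/orP; left; apply/eqP; congr (mean mu _).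
apply/funext => r; rewrite -(monomial_sqrt _ s01).
have [->|_] := eqVneq r mset0; last by rewrite !subr0.
by rewrite /monomial big_mset0 expr1n subrr expr0n.
Qed.

End GeneratingFunction.

(** * Independence and the law of the branching process *)

HB.instance Definition _ (K : choiceType) :=
  Monoid.isComLaw.Build {mset K}%mset mset0 (@msetD K)
    (@msetDA K) (@msetDC K) (@mset0D K).

Lemma perm_msetD (K : choiceType) (A B : {mset K}%mset) :
  perm_eq (A `+` B)%mset ((A : seq K) ++ (B : seq K)).
Proof. by apply/allP => a _ /=; rewrite count_cat !count_mem_mset msetE2. Qed.

Definition population_code (r : population) : nat := choice.pickle (r : seq nat).

Lemma population_code_inj : injective population_code.
Proof.
move=> r r' /(congr1 (choice.unpickle : nat -> option (seq nat))).
by rewrite !choice.pickleK => -[rr]; rewrite -(seq_mset_id r) rr seq_mset_id.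
Qed.

Lemma countable_population : countable [set: population].
Proof.
by apply/countable_injP; exists population_code => r r' _ _ /population_code_inj.
Qed.

Section Monomial.
Context {R : realType}.
Implicit Type s : nat -> R.

Lemma monomialD s (r r' : population) :
  monomial s (r `+` r')%mset = monomial s r * monomial s r'.
Proof. by rewrite /monomial (perm_big _ (perm_msetD r r')) big_cat. Qed.

Lemma monomial_sum s (I : Type) (l : seq I) (F : I -> population) :
  monomial s (\big[msetD/mset0]_(i <- l) F i) = \prod_(i <- l) monomial s (F i).
Proof.
elim: l => [|i l IH]; first by rewrite !big_nil /monomial big_mset0.
by rewrite !big_cons monomialD IH.
Qed.

End Monomial.

Section Fibers.
Context {R : realType} {d : measure_display} {T : measurableType d}.
Variable P : probability T R.
Implicit Types (A : set T) (X : T -> population).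

(** Populations form a countable set, so measurability of X reduces to its fibers and no
    sigma-algebra on populations has to be chosen. *)
Definition measurable_fibers X : Prop :=
  forall r, measurable [set w | X w = r].

Lemma measurable_fibers_preimage X (B : population -> Prop) :
  measurable_fibers X -> measurable [set w | B (X w)].
Proof.
move=> mX.
rewrite (_ : mkset _ = \bigcup_r (if pselect (B r) then [set w | X w = r] else set0)).
  apply: countable_bigcupT_measurable; first exact: countable_population.
  by move=> r; case: pselect => Br; [exact: mX|exact: measurable0].
apply/seteqP; split=> [w /= BXw|w [r _]/=].
  by exists (X w) => //; case: pselect.
by case: pselect => // Br /= ->.
Qed.

Lemma measurable_fun_fibers X (f : population -> R) A :
  measurable_fibers X -> measurable_fun A (f \o X).
Proof.
move=> mX mA Y mY; apply: measurableI => //.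
exact: (measurable_fibers_preimage (fun r => Y (f r))).
Qed.

(** Countable additivity over the fibers, indexed by [population_code]; integers that are not codes
    contribute empty sets. *)
Lemma integral_fibers A X (h : T -> \bar R) : measurable A ->
  measurable_fibers X -> measurable_fun setT h -> (forall w, 0 <= h w)%E ->
  (\int[P]_(w in A) h w =
   \esum_(r in [set: population]) \int[P]_(w in A `&` [set w | X w = r]) h w)%E.
Proof.
move=> mA mX mh h0.
pose F n := A `&` [set w | population_code (X w) = n].
have mF n : measurable (F n).
  apply: measurableI => //.
  exact: (measurable_fibers_preimage (fun r => population_code r = n)).
have AF : A = \bigcup_n F n.
  by apply/seteqP; split=> [w Aw|w [n _ []]//]; exists (population_code (X w)).
rewrite {1}AF ge0_integral_bigcup//; last 2 first.
- exact: measurable_funS mh.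
- by move=> i j _ _ [w [[_ /= <-] [_ /= <-]]].
rewrite nneseries_esumT; last by move=> n; exact: integral_ge0.
rewrite (esumID (range population_code)); last by move=> n _; exact: integral_ge0.
rewrite setTI [X in (_ + X)%E]esum1 ?adde0.
  rewrite esum_image; last by move=> r r' _ _ /population_code_inj.
  apply: eq_esum => r _; congr integral; apply/seteqP; split=> w /= [Aw].
    by move=> /population_code_inj.
  by rewrite /F => <-.
move=> n [_ /= nr]; rewrite (_ : F n = set0) ?integral_set0//.
by apply/seteqP; split=> // w [_ /= Xw]; apply: nr; exists (X w).
Qed.

Lemma measure_fibers A X : measurable A -> measurable_fibers X ->
  P A = (\esum_(r in [set: population]) P (A `&` [set w | X w = r]))%E.
Proof.
move=> mA mX; have := @integral_fibers A X (cst 1%E) mA mX.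
rewrite integral_cst// mul1e => ->; last 2 first.
- exact: measurable_cst.
- by [].
apply: eq_esum => r _; rewrite integral_cst ?mul1e//; exact: measurableI.
Qed.

End Fibers.

Section Independence.
Context {R : realType} {d : measure_display} {T : measurableType d}.
Variable P : probability T R.
Variables (p : nat -> population -> R)
  (xi : nat -> nat -> nat -> T -> population).
Hypotheses (Hp : progeny_law p) (Hxi : offspring_family P p xi).
Local Notation index := (nat * nat * nat)%type.
Implicit Types (A : set T) (U : set index) (t : index).

Let offspring t w := xi t.1.1 t.1.2 t.2 w.

Let m_offspring t : measurable_fibers (offspring t) := Hxi.1 _ _ _.

(* A is independent of the offspring variables with index in U. *)
Definition independent_of A U : Prop :=
  measurable A /\ forall (F : seq index) (r : index -> population),
    uniq F -> (forall t, t \in F -> U t) ->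
    (P (A `&` [set w | forall t, t \in F -> offspring t w = r t]) =
     P A * (\prod_(t <- F) p t.1.2 (r t))%:E)%E.

Lemma independent_of_setT U : independent_of setT U.
Proof.
split=> // F r uF _; rewrite probability_setT mul1e setTI.
rewrite (perm_big (enum_fset [fset t in F]%fset)); last first.
  by apply: uniq_perm; rewrite ?fset_uniq// => t; rewrite !inE.
rewrite -Hxi.2; congr (P _); apply/seteqP; split=> w /= H t.
  by rewrite !inE; exact: H.
by move=> tF; apply: H; rewrite !inE.
Qed.

Lemma independent_of_set0 U : independent_of set0 U.
Proof. by split=> // F r _ _; rewrite set0I measure0 mul0e. Qed.

Lemma independent_of_sub A U U' : U' `<=` U ->
  independent_of A U -> independent_of A U'.
Proof. by move=> UU' [mA HA]; split=> // F r uF FU; apply: HA => // t /FU/UU'. Qed.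

(** Revealing one variable of U costs its probability and leaves the other variables of U fresh:
    prescribe r at t and the given values elsewhere. *)
Lemma independent_of_fiber A U t r : independent_of A U -> U t ->
  P (A `&` [set w | offspring t w = r]) = (P A * (p t.1.2 r)%:E)%E /\
  independent_of (A `&` [set w | offspring t w = r]) (U `\ t).
Proof.
move=> [mA HA] Ut.
have PA : P (A `&` [set w | offspring t w = r]) = (P A * (p t.1.2 r)%:E)%E.
  have := HA [:: t] (fun=> r) isT; rewrite big_seq1 => <-.
    congr (P (_ `&` _)); apply/seteqP; split=> w /=.
      by move=> H t'; rewrite inE => /eqP ->.
    by apply; rewrite inE.
  by move=> t'; rewrite inE => /eqP ->.
split=> //; split; first by apply: measurableI => //; exact: m_offspring.
move=> F r' uF FU; rewrite PA.
have tF : t \notin F by apply/negP => /FU[_]; exact.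
have := HA (t :: F) (fun t' => if t' == t then r else r' t').
rewrite /= tF uF big_cons eqxx => /(_ isT) H.
rewrite -muleA -EFinM.
have -> : \prod_(t' <- F) p t'.1.2 (r' t') =
    \prod_(t' <- F) p t'.1.2 (if t' == t then r else r' t').
  apply: eq_big_seq => t' t'F; case: eqP => // tt'.
  by move: tF; rewrite -tt' t'F.
rewrite -H.
  rewrite -setIA; congr (P (_ `&` _)); apply/seteqP; split=> w /=.
    move=> [wt wF] t'; rewrite inE; case: eqP => [->//|_ /=]; exact: wF.
  move=> wF; split; first by have := wF t; rewrite inE eqxx; exact.
  move=> t' t'F; have := wF t'; rewrite inE t'F orbT.
  by case: eqP t'F => [->|_ _ ->//]; rewrite (negPf tF).
by move=> t'; rewrite inE => /orP[/eqP->//|/FU[]].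
Qed.

Lemma independent_of_fibers A U X : measurable A -> measurable_fibers X ->
  (forall r, independent_of (A `&` [set w | X w = r]) U) -> independent_of A U.
Proof.
move=> mA mX HA; split=> // F r uF FU.
have mE : measurable [set w | forall t, t \in F -> offspring t w = r t].
  rewrite (_ : mkset _ = \bigcap_(t in [set` F]) [set w | offspring t w = r t]).
    by apply: fin_bigcap_measurable => [|t _]; [exact: finite_seq|exact: m_offspring].
  by apply/seteqP; split=> w /= H t; exact: H.
rewrite (measure_fibers P _ mX); last exact: measurableI.
rewrite (measure_fibers P mA mX) muleC -esumZl; last 2 first.
- by apply: prodr_ge0 => t _; exact: Hp.1.
- by move=> z; exact: measure_ge0.
apply: eq_esum => z _; rewrite setIAC (HA z).2// muleC//.
Qed.

(** Induction on L: once the first variable is revealed to be r, the condition on the rest is B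
    shifted by r. *)
Lemma independent_of_sum A U (L : seq index) (B : population -> Prop) :
  independent_of A U -> uniq L -> (forall t, t \in L -> U t) ->
  independent_of
    (A `&` [set w | B (\big[msetD/mset0]_(t <- L) offspring t w)])
    (U `\` [set` L]).
Proof.
elim: L A U B => [|t L IH] A U B HA /=.
  move=> _ _; have [B0|nB0] := pselect (B mset0).
    rewrite (_ : mkset _ = setT) ?setIT; last first.
      by apply/seteqP; split=> w //= _; rewrite big_nil.
    by apply: independent_of_sub HA => t [].
  rewrite (_ : mkset _ = set0) ?setI0; last first.
    by apply/seteqP; split=> w //=; rewrite big_nil.
  exact: independent_of_set0.
move=> /andP[tL uL] LU.
have HB r : independent_of ((A `&` [set w | offspring t w = r]) `&`
   [set w | B (r `+` \big[msetD/mset0]_(t <- L) offspring t w)%mset])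
   (U `\` [set` t :: L]).
  have [_ HAr] := independent_of_fiber r HA (LU t (mem_head _ _)).
  apply: independent_of_sub (IH _ _ (fun z => B (r `+` z)%mset) HAr uL _).
    move=> t' [Ut' /= t'L]; split=> [|t'L']; last first.
      by apply: t'L; rewrite inE t'L' orbT.
    by split=> // tt'; apply: t'L; rewrite tt' inE eqxx.
  move=> t' t'L; split=> [|tt']; last by move: tL; rewrite -tt' t'L.
  by apply: LU; rewrite inE t'L orbT.
apply: (independent_of_fibers (X := offspring t)) => [||r].
- apply: measurableI; first exact: HA.1.
  suff mS : measurable_fibers (fun w => \big[msetD/mset0]_(t <- t :: L) offspring t w).
    exact: measurable_fibers_preimage.
  elim: (t :: L) => [|t' L' IHL] r.
    under eq_set do rewrite big_nil.
    have [r0|r0] := pselect (mset0 = r).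
      by rewrite (_ : mkset _ = setT)//; apply/seteqP; split.
    by rewrite (_ : mkset _ = set0)//; apply/seteqP; split.
  rewrite (_ : mkset _ = \bigcup_z ([set w | offspring t' w = z] `&`
     [set w | (z `+` \big[msetD/mset0]_(t <- L') offspring t w)%mset = r])).
    apply: countable_bigcupT_measurable; first exact: countable_population.
    move=> z; apply: measurableI; first exact: m_offspring.
    exact: (measurable_fibers_preimage (fun y => (z `+` y)%mset = r)).
  apply/seteqP; split=> w /=; rewrite big_cons.
    by move=> <-; exists (offspring t' w).
  by move=> [z _ /= [<-]].
- exact: m_offspring.
- rewrite (_ : _ `&` _ = (A `&` [set w | offspring t w = r]) `&`
   [set w | B (r `+` \big[msetD/mset0]_(t <- L) offspring t w)%mset])//.
  apply/seteqP; split=> w /=; rewrite big_cons.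
    by move=> [[Aw Bw] <-].
  by move=> [[Aw <-] Bw].
Qed.

End Independence.

(** * Generating functions of the generations and extinction *)

Section GWLaw.
Context {R : realType} {d : measure_display} {T : measurableType d}.
Variable P : probability T R.
Variables (p : nat -> population -> R)
  (xi : nat -> nat -> nat -> T -> population).
Hypotheses (Hp : progeny_law p) (Hxi : offspring_family P p xi).
Local Notation index := (nat * nat * nat)%type.
Implicit Types (A : set T) (U : set index) (t : index) (s : nat -> R).

Let offspring t w := xi t.1.1 t.1.2 t.2 w.
Let m_offspring t : measurable_fibers (offspring t) := Hxi.1 _ _ _.

Lemma progeny_mass_function i : mass_function (p i).
Proof. by split; [exact: Hp.1|exact: Hp.2]. Qed.

Definition offspring_pgf s i : R := pgf (p i) s.

Lemma step_unit_valued s : unit_valued s -> unit_valued (offspring_pgf s).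
Proof. by move=> s01 i; apply: pgf01 => //; exact: progeny_mass_function. Qed.

Lemma iter_step_unit_valued n s : unit_valued s ->
  unit_valued (iter n offspring_pgf s).
Proof. by move=> s01; elim: n => //= n; exact: step_unit_valued. Qed.

Lemma measurable_monomial s (X : T -> population) A : measurable_fibers X ->
  measurable_fun A (fun w => (monomial s (X w))%:E).
Proof.
by move=> mX; apply/measurable_EFinP; exact: (measurable_fun_fibers (monomial s)).
Qed.

(** The variables of L are revealed one at a time; on each fiber of the first its factor is
    constant, and summing over the fibers produces its generating function. *)
Lemma integral_offspring A U (L : seq index) s : unit_valued s ->
  independent_of P p xi A U -> uniq L -> (forall t, t \in L -> U t) ->
  (\int[P]_(w in A) (\prod_(t <- L) monomial s (offspring t w))%:E =
   P A * (\prod_(t <- L) offspring_pgf s t.1.2)%:E)%E.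
Proof.
move=> s01; have m0 r : 0 <= monomial s r by have /andP[] := monomial01 s01 r.
have mprod (l : seq index) D : measurable_fun D
    (fun w => (\prod_(t <- l) monomial s (offspring t w))%:E).
  apply/measurable_EFinP; apply: measurable_prod => t _.
  exact: (measurable_fun_fibers (monomial s)).
elim: L A U => [|t L IH] A U HA.
  move=> _ _; under eq_integral do rewrite big_nil.
  by rewrite integral_cst ?big_nil ?mule1 ?mul1e//; exact: HA.1.
rewrite [uniq _]/= => /andP[tL uL] LU.
have mA := HA.1.
rewrite (@integral_fibers _ _ _ P A (offspring t))//; last first.
  by move=> w; rewrite lee_fin prodr_ge0.
have c0 : 0 <= \prod_(t <- L) offspring_pgf s t.1.2.
  by rewrite prodr_ge0// => t' _; have /andP[] := step_unit_valued s01 t'.1.2.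
rewrite big_cons EFinM muleCA [RHS]muleC.
transitivity (\esum_(r in [set: population])
    ((fine (P A) * \prod_(t <- L) offspring_pgf s t.1.2)%:E *
     (p t.1.2 r * monomial s r)%:E))%E.
  apply: eq_esum => r _.
  have [PAr HAr] := independent_of_fiber Hxi r HA (LU t (mem_head _ _)).
  under eq_integral => w.
    rewrite inE => -[_ /= wr]; rewrite big_cons [offspring t w]wr EFinM; over.
  rewrite ge0_integralZl_EFin//; last 2 first.
  - exact: HAr.1.
  - by move=> w _; rewrite lee_fin prodr_ge0.
  rewrite (IH _ _ HAr)//; last first.
    move=> t' t'L; split=> [|tt']; last by move: tL; rewrite -tt' t'L.
    by apply: LU; rewrite inE t'L orbT.
  rewrite PAr -[in LHS](@fineK _ (P A)); last exact: fin_num_measure.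
  by rewrite -!EFinM; congr EFin; ring.
rewrite esumZl; last 2 first.
- by rewrite mulr_ge0// fine_ge0.
- by move=> r; rewrite lee_fin mulr_ge0//; exact: Hp.1.
rewrite EFinM (fineK (fin_num_measure P A mA)).
congr (_ * _)%E; rewrite /offspring_pgf /pgf.
by rewrite (meanE (progeny_mass_function _) (monomial01 s01)).
Qed.

(** Indices of the offspring variables consumed by generation n when its population is z. *)
Definition parents n (z : population) : seq index :=
  [seq (n, i, m) | i <- finsupp z, m <- iota 0 (z i)].

Lemma parents_uniq n z : uniq (parents n z).
Proof.
apply: allpairs_uniq_dep; first exact: fset_uniq.
  by move=> i _; exact: iota_uniq.
move=> [i m] [i' m'] _ _ /= [<- <-] //.
Qed.

Lemma mem_parents n z t : t \in parents n z -> t.1.1 = n.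
Proof. by move=> /allpairsPdep[i [m [_ _ ->]]]. Qed.

Lemma gwS i0 n w : gw xi i0 n.+1 w =
  \big[msetD/mset0]_(t <- parents n (gw xi i0 n w)) offspring t w.
Proof.
rewrite /parents big_allpairs_dep /=; apply: eq_bigr => i _.
by rewrite -(big_mkord xpredT (fun m => xi n i m w)) /index_iota subn0.
Qed.

(* Generation n only depends on the offspring of earlier generations. *)
Lemma independent_of_gw i0 n z :
  independent_of P p xi [set w | gw xi i0 n w = z] [set t | (n <= t.1.1)%N].
Proof.
elim: n z => [|n IH] z.
  have [zi|zi] := pselect ([mset i0]%mset = z).
    rewrite (_ : mkset _ = setT); first exact: independent_of_setT.
    by apply/seteqP; split.
  rewrite (_ : mkset _ = set0); first exact: independent_of_set0.
  by apply/seteqP; split.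
have Hgw z' : independent_of P p xi
    ([set w | gw xi i0 n.+1 w = z] `&` [set w | gw xi i0 n w = z'])
    [set t | (n.+1 <= t.1.1)%N].
  rewrite (_ : _ `&` _ = [set w | gw xi i0 n w = z'] `&`
    [set w | \big[msetD/mset0]_(t <- parents n z') offspring t w = z]).
    apply: independent_of_sub (independent_of_sum Hp Hxi (eq^~ z) (IH z')
      (parents_uniq n z') _).
      move=> t /= nt; split=> /=; first exact: ltnW.
      by move=> /mem_parents tn; rewrite tn ltnn in nt.
    by move=> t /mem_parents /= ->.
  apply/seteqP; split=> w [H1 H2]; split=> //.
    change (\big[msetD/mset0]_(t <- parents n z') offspring t w = z).
    by rewrite -(H2 : gw xi i0 n w = z') -gwS.
  change (gw xi i0 n.+1 w = z).
  by rewrite gwS (H1 : gw xi i0 n w = z').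
have measurable_fibers_gw : measurable_fibers (gw xi i0 n) by move=> z'; exact: (IH z').1.
apply: (independent_of_fibers Hp Hxi _ measurable_fibers_gw Hgw).
rewrite (_ : mkset _ = \bigcup_z'
    ([set w | gw xi i0 n.+1 w = z] `&` [set w | gw xi i0 n w = z'])).
  apply: countable_bigcupT_measurable; first exact: countable_population.
  by move=> z'; exact: (Hgw z').1.
by apply/seteqP; split=> [w Hw|w [z' _ []//]]; exists (gw xi i0 n w).
Qed.

Lemma measurable_fibers_gw i0 n : measurable_fibers (gw xi i0 n).
Proof. by move=> z; exact: (independent_of_gw i0 n z).1. Qed.

(** The branching property. On the event that generation n is z, the variables of [parents n z] are
    fresh, and their integral is the monomial of [offspring_pgf s] at z. Hence induction applies
    with s replaced by [offspring_pgf s]. *)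
Lemma integral_gw i0 n s : unit_valued s ->
  (\int[P]_w (monomial s (gw xi i0 n w))%:E = (iter n offspring_pgf s i0)%:E)%E.
Proof.
elim: n s => [|n IH] s s01.
  under eq_integral do rewrite /= /monomial big_msetn/=.
  rewrite integral_cst// -[RHS]mule1; congr (_ * _)%E.
  exact: probability_setT.
have m0 (s' : nat -> R) r : unit_valued s' -> (0 <= (monomial s' r)%:E)%E.
  by move=> s'01; rewrite lee_fin; have /andP[] := monomial01 s'01 r.
rewrite iterSr -IH; last exact: step_unit_valued.
rewrite (integral_fibers _ measurableT (measurable_fibers_gw i0 n)); last 2 first.
- exact: measurable_monomial (measurable_fibers_gw i0 n.+1).
- by move=> w; exact: m0.
rewrite [RHS](integral_fibers _ measurableT (measurable_fibers_gw i0 n)); last 2 first.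
- exact: measurable_monomial (measurable_fibers_gw i0 n).
- by move=> w; apply: m0; exact: step_unit_valued.
apply: eq_esum => z _; rewrite !setTI.
under eq_integral => w.
  rewrite inE => wz; rewrite gwS (wz : gw xi i0 n w = z) monomial_sum; over.
rewrite (integral_offspring s01 (independent_of_gw i0 n z) (parents_uniq n z)); last first.
  by move=> t /mem_parents /= ->.
under [RHS]eq_integral => w do rewrite inE => ->.
rewrite integral_cst; last exact: measurable_fibers_gw.
rewrite muleC; congr (_%:E * _)%E; rewrite /parents big_allpairs_dep /=.
rewrite /monomial big_mset; apply: eq_bigr => i _.
by rewrite big_const_seq count_predT size_iota Monoid.iteropE.
Qed.

Definition gw_law i0 n z : R := fine (P [set w | gw xi i0 n w = z]).

Lemma gw_lawE i0 n z : (gw_law i0 n z)%:E = P [set w | gw xi i0 n w = z].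
Proof. by rewrite /gw_law fineK// fin_num_measure//; exact: measurable_fibers_gw. Qed.

Lemma gw_pmf i0 n : mass_function (gw_law i0 n).
Proof.
split=> [z|]; first exact: fine_ge0.
rewrite -(@probability_setT _ _ _ P) (measure_fibers P measurableT (measurable_fibers_gw i0 n)).
by apply: eq_esum => z _; rewrite setTI gw_lawE.
Qed.

Lemma pgf_gw_law i0 n s : unit_valued s ->
  pgf (gw_law i0 n) s = iter n offspring_pgf s i0.
Proof.
move=> s01; apply: EFin_inj; rewrite -integral_gw//.
rewrite (integral_fibers _ measurableT (measurable_fibers_gw i0 n)); last 2 first.
- exact: measurable_monomial (measurable_fibers_gw i0 n).
- by move=> w; rewrite lee_fin; have /andP[] := monomial01 s01 (gw xi i0 n w).
rewrite /pgf (meanE (gw_pmf i0 n) (monomial01 s01)).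
apply: eq_esum => z _; rewrite setTI.
under [RHS]eq_integral => w do rewrite inE => ->.
rewrite [RHS]integral_cst; last exact: measurable_fibers_gw.
by rewrite EFinM gw_lawE muleC.
Qed.

Lemma gw_law0 i0 n : gw_law i0 n mset0 = iter n offspring_pgf (fun=> 0) i0.
Proof.
rewrite -pgf_gw_law; last by move=> j; rewrite lexx ler01.
by rewrite (pgf0 (gw_pmf i0 n)).
Qed.

Lemma gw_extinct_later i0 n m w : (n <= m)%N ->
  gw xi i0 n w = mset0 -> gw xi i0 m w = mset0.
Proof.
move=> nm Zn; elim: m nm => [|m IH]; first by rewrite leqn0 => /eqP <-.
rewrite leq_eqVlt => /orP[/eqP <-//|/IH Zm].
by rewrite gwS Zm /parents finsupp0 big_nil.
Qed.

Lemma cvg_nat_to0 (u : nat -> nat) :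
  (fun n => (u n)%:R : R) @ \oo --> (0 : R) <->
  exists N, forall n, (N <= n)%N -> u n = 0%N.
Proof.
split=> [/cvgrPdist_lt/(_ 1 ltr01)[N _ HN]|[N HN]].
  exists N => n /HN /=; rewrite sub0r normrN ger0_norm//.
  by rewrite -[1]/(1%:R) ltr_nat ltnS leqn0 => /eqP.
apply: cvg_near_cst; exists N => // n /= /HN ->.
by [].
Qed.

Lemma global_extE i0 : [set w | (fun n => (size (gw xi i0 n w))%:R : R) @ \oo --> (0 : R)] =
  \bigcup_n [set w | gw xi i0 n w = mset0].
Proof.
apply/seteqP; split=> w /=.
  move=> /cvg_nat_to0[N HN]; exists N => //=.
  apply/msetP => j; rewrite mset0E -count_mem_mset.
  by rewrite (size0nil (HN N (leqnn N))).
move=> [N _ /= ZN]; apply/cvg_nat_to0; exists N => n Nn.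
by rewrite (gw_extinct_later Nn ZN) enum_mset0.
Qed.

Lemma measurable_extinct i0 : measurable (\bigcup_n [set w | gw xi i0 n w = mset0]).
Proof. by apply: bigcupT_measurable => n; exact: measurable_fibers_gw. Qed.

Definition ext i0 : R := fine (global_ext P xi i0).

Lemma global_ext_fin i0 : global_ext P xi i0 = (ext i0)%:E.
Proof.
rewrite /ext fineK// /global_ext global_extE fin_num_measure//.
exact: measurable_extinct.
Qed.

Lemma ext_unit_valued : unit_valued ext.
Proof.
move=> i; rewrite -!lee_fin -global_ext_fin measure_ge0/= /global_ext global_extE.
apply: probability_le1; exact: measurable_extinct.
Qed.

Lemma ext_by_le i0 n : iter n offspring_pgf (fun=> 0) i0 <= ext i0.
Proof.
rewrite -gw_law0 -lee_fin gw_lawE -global_ext_fin /global_ext global_extE.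
apply: le_measure; rewrite ?inE; [exact: measurable_fibers_gw|exact: measurable_extinct|].
by move=> w Zn; exists n.
Qed.

Lemma cvg_ext i0 :
  (fun n => iter n offspring_pgf (fun=> 0) i0) @ \oo --> ext i0.
Proof.
pose F n := [set w | gw xi i0 n w = mset0].
have cvgF : P \o F @ \oo --> (ext i0)%:E.
  rewrite -global_ext_fin /global_ext global_extE.
  apply: nondecreasing_cvg_mu => [n||n m nm]; first exact: measurable_fibers_gw.
    exact: measurable_extinct.
  by apply/subsetPset => w /=; exact: gw_extinct_later.
have FE : P \o F = EFin \o (fun n => iter n offspring_pgf (fun=> 0) i0).
  by apply/funext => n; rewrite /= -gw_law0 gw_lawE.
by rewrite FE in cvgF; exact: (fine_cvg cvgF).
Qed.

Lemma ext_le_partial_ext i0 : ((ext i0)%:E <= partial_ext P xi i0)%E.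
Proof.
rewrite -global_ext_fin; apply: le_measure; rewrite ?inE/=.
- by rewrite global_extE; exact: measurable_extinct.
(* An integer sequence tends to 0 exactly when it eventually vanishes, which makes the event a
   countable combination of measurable ones. *)
- rewrite (_ : mkset _ = \bigcap_l \bigcup_N \bigcap_(n in [set n | (N <= n)%N])
      [set w | gw xi i0 n w l = 0%N]).
    apply: bigcapT_measurable => l; apply: bigcupT_measurable => N.
    apply: bigcap_measurableType => n _.
    exact: (measurable_fibers_preimage (fun r => r l = 0%N)) (measurable_fibers_gw i0 n).
  apply/seteqP; split=> w /= H l.
    by have /cvg_nat_to0[N HN] := H l; exists N.
  by have [N _ HN] := H l Logic.I; apply/cvg_nat_to0; exists N.
- move=> w /cvg_nat_to0[N HN] l; apply/cvg_nat_to0; exists N => n /HN s0.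
  by rewrite -count_mem_mset (size0nil s0).
Qed.

End GWLaw.

(** * Types with exactly one child *)

Lemma exchange_esum (R : realType) (I J : choiceType) (A : set I) (B : set J)
    (f : I -> J -> \bar R) : (forall i j, 0 <= f i j)%E ->
  (\esum_(i in A) \esum_(j in B) f i j = \esum_(j in B) \esum_(i in A) f i j)%E.
Proof.
move=> f0; rewrite !esum_esum//.
rewrite [RHS](@reindex_esum _ _ _ (A `*`` (fun=> B)) _ (fun x => (x.2, x.1)))//.
split=> [[i j] [/=]//|[i j] [i' j'] _ _ [-> ->]//|[j i] [/= Bj Ai]].
by exists (i, j).
Qed.

Lemma sum_count_fset (A : {fset nat}) (l : seq nat) :
  (\sum_(j <- A) count_mem j l)%N = count (fun x => x \in A) l.
Proof.
elim: l => [|x l IH]; first by rewrite big1.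
rewrite /= big_split/= IH; congr addn.
have [xA|xA] := boolP (x \in A).
  rewrite (big_fsetD1 x)//= eqxx big1_fset ?addn0// => j.
  by rewrite !inE => /andP[/negPf jx _] _; rewrite eq_sym jx.
by rewrite big1_fset// => j jA _; case: eqP => // xj; rewrite xj jA in xA.
Qed.

Section Means.
Context {R : realType}.
Variable p : nat -> population -> R.
Hypotheses (Hp : progeny_law p) (Hrow : finite_row_sums p).

Let p_mass i : mass_function (p i) := progeny_mass_function Hp i.

Lemma mean_progeny_ge0 i j : (0 <= mean_progeny p i j)%E.
Proof. exact: (expect_ge0 (p_mass i)). Qed.

(** Tonelli: summing the multiplicities of a population over the types from k on counts its
    individuals of those types. *)
Lemma tail_mean i k : (\sum_(k <= j <oo) mean_progeny p i j)%E =
  expect (p i) (fun r : population => (count (fun j => (k <= j)%N) r)%:R).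
Proof.
have -> : (\sum_(k <= j <oo) mean_progeny p i j)%E =
    (\sum_(j <oo | (k <= j)%N) mean_progeny p i j)%E.
  by apply/congr_lim/funext => n /=; rewrite (big_nat_widenl k 0%N).
rewrite nneseries_esum; last by move=> j _; exact: mean_progeny_ge0.
rewrite /mean_progeny exchange_esum; last first.
  by move=> j r; rewrite lee_fin mulr_ge0//; exact: Hp.1.
apply: eq_esum => r _.
under eq_esum do rewrite EFinM.
rewrite esumZl//; last exact: Hp.1.
rewrite EFinM; congr (_ * _)%E.
rewrite (eq_esum (b := fun j => (count_mem j (r : population))%:R%:E)); last first.
  by move=> j _; rewrite count_mem_mset.
elim: (enum_mset r) => [|x l IH]; first by rewrite esum1.
under eq_esum do rewrite /= natrD EFinD.
rewrite esumD// IH /= natrD EFinD; congr (_ + _)%E.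
rewrite (esumID [set x])//.
rewrite [X in (_ + X)%E]esum1 ?adde0; last first.
  by move=> j [_ /= /eqP]; rewrite eq_sym => /negPf ->.
have [kx|kx] := boolP (k <= x)%N.
  rewrite (_ : _ `&` _ = [set x]); first by rewrite esum_set1// eqxx.
  by apply/seteqP; split=> j /= => [[]|->].
rewrite (_ : _ `&` _ = set0) ?esum_set0//.
by apply/seteqP; split=> j //= [kj jx]; move: kx; rewrite -jx kj.
Qed.

Lemma mean_size_fin i : expect (p i) (fun r : population => (size r)%:R) \is a fin_num.
Proof.
rewrite ge0_fin_numE; last exact: (expect_ge0 (p_mass i)).
have := Hrow i; rewrite tail_mean; apply: le_lt_trans.
by apply: (expect_le (p_mass i)) => r; rewrite -count_predT.
Qed.

Lemma expect_le_size_fin i f : (forall r : population, 0 <= f r <= (size r)%:R) ->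
  expect (p i) f \is a fin_num.
Proof.
move=> fs; rewrite ge0_fin_numE; last first.
  by apply: (expect_ge0 (p_mass i)) => r; have /andP[] := fs r.
apply: (@le_lt_trans _ _ (expect (p i) (fun r : population => (size r)%:R))).
  by apply: (expect_le (p_mass i)) => r; have /andP[] := fs r.
by rewrite -ge0_fin_numE ?mean_size_fin//; exact: (expect_ge0 (p_mass i)).
Qed.

Lemma mean_progeny_fin i j : mean_progeny p i j \is a fin_num.
Proof.
apply: expect_le_size_fin => r.
by rewrite ler0n ler_nat -count_mem_mset count_size.
Qed.

Lemma mean_progeny_gt0 i j r : 0 < p i r -> (0 < r j)%N ->
  (0 < mean_progeny p i j)%E.
Proof.
move=> pr rj; rewrite lt_neqAle mean_progeny_ge0 andbT; apply/negP => /eqP/esym M0.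
have f0 (z : population) : (0 <= (p i z * (z j)%:R)%:E :> \bar R)%E.
  by rewrite lee_fin mulr_ge0//; exact: Hp.1.
have /eqP := esum_eq0 f0 M0 r; rewrite eqe mulf_eq0 gt_eqF//= pnatr_eq0 => /eqP r0.
by rewrite r0 in rj.
Qed.

Lemma mean_progeny_gt0_ex i j : (0 < mean_progeny p i j)%E ->
  exists2 r, 0 < p i r & (0 < r j)%N.
Proof.
move=> M0; apply: contrapT => H; move: M0.
rewrite /mean_progeny esum1 ?ltxx// => r _.
have [->|pr] := eqVneq (p i r) 0; first by rewrite mul0r.
have [rj|] := posnP (r j); first by rewrite rj mulr0.
by move=> rj; exfalso; apply: H; exists r => //; rewrite lt_def pr Hp.1.
Qed.

(** A child outside the first k types is replaced by one drawn from alpha, worth alpha v on average.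
    Thus b is the mean value of a child, and its sum over the offspring is the first moment encoded
    by the augmented matrix. *)
Lemma expect_aug_mean (k : nat) (alpha : 'rV[R]_k) (v : 'cV[R]_k) (b : nat -> R) :
  (forall i, 0 <= v i 0) -> 0 <= \sum_j alpha 0 j * v j 0 ->
  (forall i : 'I_k, b i = v i 0) ->
  (forall j, (k <= j)%N -> b j = \sum_j alpha 0 j * v j 0) ->
  forall i : 'I_k, expect (p i) (fun r : population => \sum_(x <- r) b x) =
    ((aug_mean p alpha *m v) i 0)%:E.
Proof.
set beta := \sum_j _ => v0 beta0 bv bbeta i.
pose tail (l : seq nat) : R := (count (fun j => (k <= j)%N) l)%:R.
have sumE (l : seq nat) : \sum_(x <- l) b x =
    \sum_(j < k) v j 0 * (count_mem (val j) l)%:R + beta * tail l.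
  rewrite /tail; elim: l => [|x l IH].
    by rewrite big_nil/= mulr0 addr0 big1// => j _; rewrite mulr0.
  rewrite big_cons IH/= natrD mulrDr.
  under [in RHS]eq_bigr do rewrite natrD mulrDr.
  rewrite big_split/= [RHS]addrACA; congr +%R.
  have [kx|xk] := leqP k x.
    rewrite mulr1 bbeta// big1 ?add0r// => j _; case: eqP => [xj|]; rewrite ?mulr0//.
    by move: (ltn_ord j); rewrite -xj ltnNge kx.
  rewrite mulr0 addr0 (bigD1 (Ordinal xk))//= eqxx mulr1 -bv /= big1 ?addr0// => j jx.
  by case: eqP => [xj|]; rewrite ?mulr0//; case/eqP: jx; apply: val_inj.
rewrite (@eq_expect _ _ _ _ (fun r : population =>
    \sum_(j < k) v j 0 * (r j)%:R + beta * tail r)); last first.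
  by move=> r; rewrite sumE; congr +%R; apply: eq_bigr => j _; rewrite count_mem_mset.
have tail_fin : expect (p i) (fun r : population => tail r) \is a fin_num.
  by apply: expect_le_size_fin => r; rewrite ler0n ler_nat count_size.
rewrite (expectD (p_mass i)); last 2 first.
- by move=> r; rewrite sumr_ge0// => j _; rewrite mulr_ge0.
- by move=> r; rewrite mulr_ge0.
rewrite (expectZ (p_mass i))//.
have -> : expect (p i) (fun r : population => \sum_(j < k) v j 0 * (r j)%:R) =
    (\sum_(j < k) fine (mean_progeny p i j) * v j 0)%:E.
  rewrite /expect; under eq_esum do rewrite mulr_sumr -sumEFin.
  rewrite esum_sum; last first.
    by move=> r j _ _; rewrite lee_fin !mulr_ge0//; exact: Hp.1.
  rewrite -sumEFin; apply: eq_bigr => j _.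
  rewrite -/(expect (p i) (fun r : population => v j 0 * (r j)%:R)).
  by rewrite (expectZ (p_mass i))// EFinM muleC fineK ?mean_progeny_fin.
rewrite -(fineK tail_fin) -EFinM -EFinD; congr EFin.
rewrite /aug_mean mulmxDl -mulmxA [RHS]mxE; congr +%R.
  by rewrite mxE; apply: eq_bigr => j _; rewrite mxE.
by rewrite mxE big_ord1 !mxE -tail_mean mulrC.
Qed.

Lemma aug_mean_ge k (alpha : 'rV[R]_k) : (forall j, 0 <= alpha 0 j) ->
  forall i j : 'I_k, fine (mean_progeny p i j) <= aug_mean p alpha i j.
Proof.
move=> alpha0 i j; rewrite !mxE lerDl big_ord1 !mxE mulr_ge0// fine_ge0//.
by rewrite tail_mean (expect_ge0 (p_mass i)).
Qed.

Lemma mean_progeny_fine_gt0 i j : (0 < mean_progeny p i j)%E ->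
  0 < fine (mean_progeny p i j).
Proof. by move=> M0; rewrite fine_gt0// M0 ltey_eq mean_progeny_fin. Qed.

End Means.

(** * From equality in the union bound to types with one child *)

Section Singular.
Context {R : realType}.
Variable p : nat -> population -> R.
Hypotheses (Hp : progeny_law p) (Hrow : finite_row_sums p).

Let p_mass i : mass_function (p i) := progeny_mass_function Hp i.

Lemma eq_expect_support (mu f g : population -> R) : (forall r, 0 <= mu r) ->
  (forall r, 0 < mu r -> f r = g r) -> expect mu f = expect mu g.
Proof.
move=> mu0 fg; apply: eq_esum => r _; congr EFin.
by have [/fg->//|mur] := ltP 0 (mu r); have -> : mu r = 0; rewrite ?mul0r//;
  apply/eqP; rewrite eq_le mur mu0.
Qed.

(** This is [final_class] without communication. The equality case of the union bound yields such a
    set, and a minimal one is the candidate final class. *)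
Definition singular (C : {fset nat}) : Prop := (exists i, i \in C) /\
  forall i r, i \in C -> 0 < p i r -> (\sum_(j <- C) r j)%N = 1%N.

Lemma singular_of_supersolution k (alpha : 'rV[R]_k) (y : nat -> R) :
  (forall j, 0 <= alpha 0 j) -> no_eigenvalue_gt1 (aug_mean p alpha) ->
  unit_valued y -> (forall i, (i < k)%N -> pgf (p i) y <= y i) ->
  (forall j, (k <= j)%N -> y j = 1 \/ 1 - y j < \sum_l alpha 0 l * (1 - y l)) ->
  (exists2 i, (i < k)%N & y i < 1) -> exists C, singular C.
Proof.
move=> alpha0 HA y01 ysup yout [i0 i0k yi0].
pose v : 'cV[R]_k := \col_i (1 - y i).
have vE i : v i 0 = 1 - y i by rewrite mxE.
have v0 i : 0 <= v i 0 by rewrite vE subr_ge0; have /andP[] := y01 i.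
pose beta := \sum_j alpha 0 j * v j 0.
have betaE : \sum_l alpha 0 l * (1 - y l) = beta.
  by apply: eq_bigr => l _; rewrite vE.
have beta0 : 0 <= beta by rewrite sumr_ge0// => j _; rewrite mulr_ge0.
(* The augmented process gives weight beta to every type outside the first k. *)
pose b j := if (j < k)%N then 1 - y j else beta.
have b0 j : 0 <= b j.
  by rewrite /b; case: ifP => // _; rewrite subr_ge0; have /andP[] := y01 j.
have yb j : 1 - y j <= b j.
  rewrite /b; case: ltnP => // kj.
  by have [->|] := yout _ kj; rewrite ?subrr// betaE => /ltW.
have augE (i : 'I_k) : expect (p i) (fun r : population => \sum_(x <- r) b x) =
    ((aug_mean p alpha *m v) i 0)%:E.
  apply: expect_aug_mean => // [j|j kj]; first by rewrite /b ltn_ord vE.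
  by rewrite /b ltnNge kj.
have A0 i j : 0 <= aug_mean p alpha i j.
  apply: le_trans (aug_mean_ge Hp alpha0 i j).
  by rewrite fine_ge0// mean_progeny_ge0.
have pgfE (i : nat) : (pgf (p i) y)%:E = expect (p i) (monomial y).
  exact: (meanE (p_mass i) (monomial01 y01)).
have bsum0 (r : seq nat) : 0 <= \sum_(x <- r) b x by rewrite sumr_ge0.
have ptwise (r : population) : 1 <= monomial y r + \sum_(x <- r) b x.
  apply: le_trans (one_le_prod_sum y01 r) _; rewrite lerD2l.
  by apply: ler_sum => x _.
have expE (i : 'I_k) : expect (p i) (fun r : population =>
    monomial y r + \sum_(x <- r) b x) =
    (pgf (p i) y + (aug_mean p alpha *m v) i 0)%:E.
  rewrite (expectD (p_mass i)) ?augE -?pgfE//.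
  by move=> r; have /andP[] := monomial01 y01 r.
have one_exp (i : nat) : expect (p i) (fun=> 1) = 1%E by rewrite (expect_cst (p_mass i)).
have Av i : v i 0 <= (aug_mean p alpha *m v) i 0.
  have : (1 <= (pgf (p i) y + (aug_mean p alpha *m v) i 0)%:E)%E.
    by rewrite -expE -(one_exp i); exact: (expect_le (p_mass i)).
  by rewrite lee_fin vE; have := ysup i (ltn_ord i); lra.
have [|C [[c cC] HC closedC]] := subinvariant_equality A0 HA v0 Av.
  by exists (Ordinal i0k); rewrite vE subr_gt0.
(* On C the mean of the left side is the pgf of y plus A v, at most y + v = 1; so the pointwise
   bound is attained on the support. *)
have rigid (i : 'I_k) (r : population) : i \in C -> 0 < p i r ->
    monomial y r + \sum_(x <- r) b x = 1.
  move=> iC pir; apply/esym.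
  apply: (expect_eq (p_mass i) _ ptwise _ _ pir) => //; first by rewrite one_exp.
  rewrite one_exp; apply/eqP; rewrite eq_le; apply/andP; split.
    by rewrite -(one_exp i); exact: (expect_le (p_mass i)).
  have [_ vi] := HC i iC.
  by rewrite expE lee_fin vi vE; have := ysup i (ltn_ord i); lra.
(* Two nonnegative slacks, that of the union bound and that of b over 1 - y, add up to 0. *)
have rigid2 (i : 'I_k) (r : population) : i \in C -> 0 < p i r ->
    \sum_(x <- r) b x = \sum_(x <- r) (1 - y x) /\
    forall x, x \in (r : seq nat) -> b x = 1 - y x.
  move=> iC pir; have E := rigid i r iC pir; have L := one_le_prod_sum y01 r.
  have S : \sum_(x <- r) (b x - (1 - y x)) = 0.
    apply/eqP; rewrite eq_le sumr_ge0 ?andbT => [|x _]; last by rewrite subr_ge0.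
    by rewrite big_split/= sumrN; move: E L; rewrite /monomial; lra.
  split; first by move: S; rewrite big_split/= sumrN; lra.
  move/eqP: S; rewrite psumr_eq0 => [/allP H x xr|x _]; last by rewrite subr_ge0.
  by have /= := H x xr; rewrite subr_eq0 => /eqP.
(* Below k this is closedness of C. From k on, y x < 1 would make b x = beta strictly larger than 1
   - y x, against [rigid2]. *)
have childC (i : 'I_k) (r : population) x : i \in C -> 0 < p i r ->
    x \in (r : seq nat) -> y x < 1 -> exists2 j : 'I_k, j \in C & val j = x.
  move=> iC pir xr yx; have bx := (rigid2 i r iC pir).2 x xr.
  have [xk|kx] := ltnP x k.
    exists (Ordinal xk) => //; apply: (closedC i) => //; last by rewrite vE subr_gt0.
    apply: lt_le_trans (aug_mean_ge Hp alpha0 i (Ordinal xk)).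
    apply: (mean_progeny_fine_gt0 Hp Hrow).
    by apply: (mean_progeny_gt0 Hp pir); rewrite -in_mset.
  move: bx; rewrite /b ltnNge kx/=.
  have [yx1|] := yout x kx; first by rewrite yx1 ltxx in yx.
  by rewrite betaE => lt eq; rewrite -eq ltxx in lt.
(* An individual with a type of C has at most one child x with y x < 1, and its
   mean over the offspring is the maximum of v at a maximizing type. *)
case: (@arg_maxP _ _ _ c (mem C) (fun i => v i 0) cC) => cm cmC Hcm.
pose C' := [fset val i | i in [pred i : 'I_k | (i \in C) && (v i 0 == v cm 0)]]%fset.
have mem_C' (i : 'I_k) : (val i \in C') = (i \in C) && (v i 0 == v cm 0).
  apply/imfsetP/idP => /= [[j]|iC]; last by exists i.
  by rewrite inE => /andP[jC vj] /val_inj ->; rewrite jC.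
have C'P x : x \in C' -> exists2 i : 'I_k, (i \in C) && (v i 0 == v cm 0) & x = val i.
  by move=> /imfsetP[i /= Hi ->]; exists i.
exists C'; split; first by exists (val cm); rewrite mem_C' eqxx andbT.
have sum_le (i : 'I_k) (r : population) : i \in C -> 0 < p i r ->
    \sum_(x <- r) b x <= v cm 0.
  move=> iC pir; have [-> Hb] := rigid2 i r iC pir.
  have := rigid i r iC pir; rewrite (rigid2 i r iC pir).1 => E.
  have [H|[x [l' [pl yx Hl']]]] := one_eq_prod_sum y01 E.
    rewrite big_seq big1 => [|x /H ->]; first exact: v0.
    by rewrite subrr.
  rewrite (perm_big _ pl) /= big_cons big_seq big1 => [|z /Hl' ->]; last by rewrite subrr.
  have xr : x \in (r : seq nat) by rewrite (perm_mem pl) mem_head.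
  have [j jC <-] := childC i r x iC pir xr yx.
  by rewrite addr0 -vE; exact: Hcm.
move=> _ r /C'P[i /andP[iC /eqP vi] ->] pir.
have sum_eq : \sum_(x <- r) b x = v cm 0.
  (* The bound [sum_le] is available on the support only, hence the value 0 elsewhere. The mean of f
     equals its upper bound, so f attains the bound on the support. *)
  pose f (z : population) : R := if 0 < p i z then \sum_(x <- z) b x else 0.
  have fE : expect (p i) f = (v cm 0)%:E.
    rewrite -vi -(HC i iC).2 -augE; apply: eq_expect_support; first exact: (p_mass i).1.
    by move=> z; rewrite /f => ->.
  have := @expect_eq _ _ _ (p_mass i) f (fun=> v cm 0) _ _ _ _ r pir.
  rewrite /f pir; apply.
  - by move=> z; case: ifP.
  - by move=> z; case: ifP => [pz|_ //]; exact: (sum_le i).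
  - by rewrite fE.
  - by rewrite fE (expect_cst (p_mass i)).
have := rigid i r iC pir; rewrite (rigid2 i r iC pir).1 => E.
under eq_bigr do rewrite -count_mem_mset.
rewrite sum_count_fset.
have [H|[x [l' [pl yx Hl']]]] := one_eq_prod_sum y01 E.
  move: sum_eq; rewrite (rigid2 i r iC pir).1 big_seq big1 => [v0'|x /H ->]; last by rewrite subrr.
  by have := (HC cm cmC).1; rewrite -v0' ltxx.
have xr : x \in (r : seq nat) by rewrite (perm_mem pl) mem_head.
(* The child x carries the whole sum, so its v-value is the maximum and x lies in C'. The other
   children have y = 1, whereas v is positive on C'. *)
have [j jC jx] := childC i r x iC pir xr yx.
rewrite (permP pl) /= -jx mem_C' jC/=.
move: sum_eq; rewrite (rigid2 i r iC pir).1 (perm_big _ pl) /= big_cons.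
rewrite big_seq big1 => [|z /Hl' ->]; last by rewrite subrr.
rewrite addr0 -jx -vE => ->; rewrite eqxx.
rewrite (_ : count _ l' = 0%N)//; apply/eqP; rewrite -leqn0 leqNgt -has_count.
apply/hasPn => z /Hl' yz; apply/negP => /C'P[j' /andP[_ /eqP vj'] zj'].
by have := (HC cm cmC).1; rewrite -vj' vE -zj' yz subrr ltxx.
Qed.

End Singular.

(** * Excluding singular sets of types *)

Section NoSingular.
Context {R : realType}.
Variable p : nat -> population -> R.
Hypotheses (Hp : progeny_law p) (Hrow : finite_row_sums p).

Let p_mass i : mass_function (p i) := progeny_mass_function Hp i.

Local Notation edge := (fun u v => (0 < mean_progeny p u v)%E).

Lemma minimal_singular C : singular p C -> exists2 D, singular p D &
  forall D', singular p D' -> (#|` D| <= #|` D'|)%N.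
Proof.
move=> sC; pose S n := `[< exists2 D, singular p D & #|` D| = n >].
have exS : exists n, S n by exists #|` C|; apply/asboolP; exists C.
case: (ex_minnP exS) => n /asboolP[D sD Dn] Hn; exists D => // D' sD'.
by rewrite Dn; apply: Hn; apply/asboolP; exists D'.
Qed.

(** The types reachable from i inside D form a singular set, because the only child in D of a
    reachable type is reachable. By minimality this set is D. *)
Lemma minimal_singular_connected D : singular p D ->
  (forall D', singular p D' -> (#|` D| <= #|` D'|)%N) ->
  forall i j, i \in D -> j \in D ->
  exists s, [/\ path edge i s, {subset s <= D} & last i s = j].
Proof.
move=> sD minD i j iD.
pose reach l := exists s, [/\ path edge i s, {subset s <= D} & last i s = l].
pose D' := [fset l in D | `[< reach l >]]%fset.
have mem_D' l : (l \in D') = (l \in D) && `[< reach l >] by rewrite !inE.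
have sD' : singular p D'.
  split; first by exists i; rewrite mem_D' iD; apply/asboolP; exists [::]; split.
  move=> u r; rewrite mem_D' => /andP[uD /asboolP[s [ps sD'] lastu]] pur.
  rewrite -(sD.2 u r uD pur) /D' big_fset/=.
  rewrite [RHS](bigID (fun l => `[< reach l >]))/= [X in (_ + X)%N]big1_fset ?addn0//.
  move=> l lD /asboolP nreach; apply/eqP; rewrite -leqn0 leqNgt; apply/negP => rl.
  apply: nreach; exists (rcons s l); split; last by rewrite last_rcons.
    by rewrite rcons_path ps lastu (mean_progeny_gt0 Hp pur rl).
  by move=> z; rewrite mem_rcons inE => /orP[/eqP->|/sD'].
have D'D : D' = D.
  apply/eqP; rewrite eqEfcard minD// andbT; apply/fsubsetP => l.
  by rewrite mem_D' => /andP[].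
by rewrite -{1}D'D mem_D' => /andP[_ /asboolP].
Qed.

Lemma path_exit (D : {fset nat}) i s : i \in D -> path edge i s ->
  last i s \notin D ->
  exists i0 u, [/\ i0 \in D, u \notin D, edge i0 u & has_path p u (last i s)].
Proof.
elim: s i => [|x s IH] i iD /=; first by rewrite iD.
move=> /andP[ix ps] lD; have [xD|xD] := boolP (x \in D); first exact: IH ps lD.
by exists i, x; split=> //; exists s.
Qed.

Hypothesis Hnonsing : forall C : {fset nat}, ~ final_class p C.
Hypothesis Hsub : forall K : nat, exists k (alpha : 'rV[R]_k),
  [/\ (K <= k)%N, forall j, 0 <= alpha 0 j & no_eigenvalue_gt1 (aug_mean p alpha)].

Lemma not_singular C : ~ singular p C.
Proof.
move=> /minimal_singular[D sD minD].
have conn := minimal_singular_connected sD minD.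
apply: (Hnonsing (C := D)); split; first exact: sD.1; last exact: sD.2.
move=> i j iD; split=> [jD|[[s [ps lasts]] [s' [ps' lasts']]]].
  by split; [have [s [? _ ?]] := conn _ _ iD jD|have [s [? _ ?]] := conn _ _ jD iD];
    exists s.
apply: contrapT => /negP jD.
have [i0 [u [i0D uD i0u [s1 [ps1 lasts1]]]]] : exists i0 u,
    [/\ i0 \in D, u \notin D, edge i0 u & has_path p u j].
  by rewrite -lasts; apply: path_exit; rewrite ?lasts.
pose t := s1 ++ s'.
have pt : path edge u t by rewrite cat_path ps1 lasts1.
have lastt : last u t = i by rewrite last_cat lasts1.
(* k exceeds every type of D and of the path t from u back into D, so all of them survive the
   truncation. *)
have [k [alpha [Kk alpha0 HA]]] :=
  Hsub (\max_(x <- enum_fset D ++ u :: t) x).+1.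
have in_k x : x \in D \/ x \in u :: t -> (x < k)%N.
  move=> Hx; apply: leq_trans Kk; rewrite ltnS.
  apply: (@leq_bigmax_seq nat (enum_fset D ++ u :: t) xpredT id x) => //; rewrite mem_cat.
  by apply/orP; case: Hx; [left|right].
set B := aug_mean p alpha in HA.
have BM : forall i j : 'I_k, fine (mean_progeny p i j) <= B i j := aug_mean_ge Hp alpha0.
have B0 i' j' : 0 <= B i' j'.
  by apply: le_trans (BM i' j'); rewrite fine_ge0// mean_progeny_ge0.
have Bedge (i' j' : 'I_k) : edge i' j' -> 0 < B i' j'.
  by move=> /(mean_progeny_fine_gt0 Hp Hrow)/lt_le_trans; apply; exact: BM.
pose v0 : 'cV[R]_k := \col_l (val l \in D)%:R.
have v0E l : v0 l 0 = (val l \in D)%:R by rewrite mxE.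
have v00 l : 0 <= v0 l 0 by rewrite v0E ler0n.
pose beta := \sum_j alpha 0 j * v0 j 0.
have beta0 : 0 <= beta by rewrite sumr_ge0// => l _; rewrite mulr_ge0.
(* Every possible offspring of a type of D has one child in D, and D lies below k, so the mean of b
   is at least 1. *)
have Bv0 l : v0 l 0 <= (B *m v0) l 0.
  rewrite v0E; have [lD|_] := boolP (val l \in D); last exact: mulmx_ge0.
  pose b x : R := if (x < k)%N then (x \in D)%:R else beta.
  have b0 x : 0 <= b x by rewrite /b; case: ifP.
  rewrite -lee_fin -(@expect_aug_mean _ _ Hp Hrow _ alpha v0 b)//; last 2 first.
  - by move=> l'; rewrite /b ltn_ord v0E.
  - by move=> x kx; rewrite /b ltnNge kx.
  rewrite -(expect_cst (p_mass l) ler01).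
  rewrite (_ : expect _ _ =
      expect (p l) (fun r => if 0 < p l r then 1 else 0)); last first.
    by apply: eq_expect_support => [|r ->//]; exact: (p_mass l).1.
  apply: (expect_le (p_mass l)) => r; case: ifP => [plr|_]; last exact: sumr_ge0.
  have := sD.2 _ _ lD plr; under eq_bigr do rewrite -count_mem_mset.
  rewrite sum_count_fset => cD.
  rewrite -[1]/(1%:R) -cD -sum1_count natr_sum big_mkcond/=.
  apply: ler_sum => x _; case: ifP => xD //; rewrite /b xD.
  by rewrite in_k//; left.
pose Q m (w : 'cV[R]_k) : 'cV[R]_k := iter m (mulmx B) w.
have Qv0 m l : v0 l 0 <= Q m v0 l 0.
  elim: m l => [|m IH] l //=; apply: le_trans (Bv0 l) _; exact: mulmx_mono.
have Q0 m l : 0 <= Q m v0 l 0 by apply: le_trans (Qv0 m l).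
(* A path of length m from x into D contributes a positive term to B^m 1_D at x. *)
have Qpath (x : 'I_k) (l : seq nat) : {subset l <= u :: t} -> path edge x l ->
    last (val x) l \in D -> 0 < Q (size l) v0 x 0.
  elim: l x => [|z l IH] x /= lt; first by move=> _ xD; rewrite v0E xD.
  move=> /andP[xz pl] lastD.
  have zk : (z < k)%N by apply: in_k; right; apply: lt; rewrite mem_head.
  rewrite mxE (bigD1 (Ordinal zk))//= ltr_pwDl//.
    rewrite mulr_gt0//; first exact: (Bedge x (Ordinal zk)).
    by apply: IH => // z' z'l; apply: lt; rewrite inE z'l orbT.
  by rewrite sumr_ge0// => z' _; rewrite mulr_ge0.
have uk : (u < k)%N by apply: in_k; right; rewrite mem_head.
have i0k : (i0 < k)%N by apply: in_k; left.
pose n := size t.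
have Qu : 0 < Q n v0 (Ordinal uk) 0.
  by apply: Qpath => //; [move=> z zt; rewrite inE zt orbT|rewrite /= lastt].
(* B w - w = B^(n+1) 1_D - 1_D is nonnegative, and positive at i0 because i0 has
   an edge to u outside D, from which D is reached in n steps. *)
pose w : 'cV[R]_k := \sum_(m < n.+1) Q m v0.
have wE l : w l 0 = \sum_(m < n.+1) Q m v0 l 0 by rewrite summxE.
have wQ m l : (m <= n)%N -> Q m v0 l 0 <= w l 0.
  move=> mn; rewrite wE (bigD1 (Ordinal (mn : m < n.+1)%N))//= lerDl.
  by rewrite sumr_ge0.
have w0 l : 0 <= w l 0 by rewrite wE sumr_ge0.
have Bw : v0 + B *m w = w + Q n.+1 v0.
  rewrite /w mulmx_sumr [in RHS]big_ord_recl/= -[in RHS]addrA; congr (_ + _).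
  by rewrite big_ord_recr/=; congr +%R; apply: eq_bigr => m _.
have BwE l : (B *m w) l 0 = w l 0 + (Q n.+1 v0 l 0 - v0 l 0).
  have /matrixP/(_ l 0) := Bw; rewrite [LHS]mxE [RHS]mxE => H; lra.
have [||c [[x xc] Hc closedc]] := @subinvariant_equality _ _ B w B0 HA w0.
- by move=> l; rewrite BwE lerDl subr_ge0.
- exists (Ordinal i0k); apply: lt_le_trans (wQ 0%N _ _) => //.
  by rewrite /= v0E i0D.
(* Positivity of B^m 1_D at l gives an edge to a type where B^(m-1) 1_D is positive. Closedness of c
   keeps this walk in c until it meets D. *)
have meet m l : (m <= n)%N -> l \in c -> 0 < Q m v0 l 0 ->
    exists2 z, z \in c & val z \in D.
  elim: m l => [|m IH] l mn lc.
    by rewrite /= v0E; case: (boolP (val l \in D)) => [lD _|_]; [exists l|rewrite ltxx].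
  rewrite /= mxE => pos.
  have [z _ Bz] : exists2 z, true & 0 < B l z * Q m v0 z 0.
    apply: contrapT => Hn; move: pos; rewrite ltNge; apply/negP; rewrite negbK.
    rewrite sumr_le0// => z _; rewrite leNgt; apply/negP => Bz; apply: Hn.
    by exists z.
  have Qz : 0 < Q m v0 z 0.
    by rewrite lt_def Q0 andbT; apply/eqP => Qz; move: Bz; rewrite Qz mulr0 ltxx.
  apply: (IH z (ltnW mn) _ Qz); apply: (closedc l) => //.
    by rewrite -(pmulr_lgt0 _ Qz).
  exact: lt_le_trans (wQ m z (ltnW mn)).
have [z zc zD] : exists2 z, z \in c & val z \in D.
  have : 0 < w x 0 := (Hc x xc).1.
  rewrite wE => pos; have [m _ Qm] : exists2 m : 'I_n.+1, true & 0 < Q m v0 x 0.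
    apply: contrapT => Hn; move: pos; rewrite ltNge; apply/negP; rewrite negbK.
    rewrite sumr_le0// => m _; rewrite leNgt; apply/negP => Bz; apply: Hn.
    by exists m.
  by apply: (meet m x) => //; rewrite -ltnS.
(* D is connected and w is at least 1 on D, so closedness carries c along D to i0. *)
have i0c : Ordinal i0k \in c.
  have [l [pl lD lastl]] := conn _ _ zD i0D.
  elim: l z zc zD pl lD lastl => [|z' l IH] z zc zD /=.
    by move=> _ _ zi0; rewrite (_ : Ordinal i0k = z)//; apply: val_inj.
  move=> /andP[zz' pl] lD lastl.
  have z'D : z' \in D by apply: lD; rewrite mem_head.
  have z'k : (z' < k)%N by apply: in_k; left.
  apply: (IH (Ordinal z'k)) => //; last first.
    by move=> a al; apply: lD; rewrite inE al orbT.
  apply: (closedc z) => //; first exact: Bedge.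
  by apply: lt_le_trans (wQ 0%N _ _) => //; rewrite /= v0E z'D.
(* Equality at i0 would mean B^(n+1) 1_D = 1_D there, whereas the edge to u makes B^(n+1) 1_D > B
   1_D >= 1_D. *)
have [_] := Hc _ i0c; rewrite BwE => /eqP; rewrite -subr_eq0 addrAC subrr add0r subr_eq0.
apply/negP; rewrite gt_eqF//.
apply: le_lt_trans (Bv0 _) _.
rewrite /= !mxE -subr_gt0 -sumrB (bigD1 (Ordinal uk))//= ltr_pwDl//.
  rewrite -mulrBr v0E /= (negPf uD) subr0 mulr_gt0//.
  exact: (Bedge (Ordinal i0k) (Ordinal uk)).
by rewrite sumr_ge0// => l _; rewrite -mulrBr mulr_ge0// subr_ge0.
Qed.

End NoSingular.

(** * The extinction probability *)

Lemma PF_no_eigenvalue_gt1 (R : realType) (k : nat) (A : 'M[R]_k) (rho : R) :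
  is_PF_eigenvalue A rho -> rho <= 1 -> no_eigenvalue_gt1 A.
Proof.
move=> [_ Hrho] rho1 x x1; apply/negP => Ax.
have x0 : 0 < x by apply: lt_trans x1.
have := Hrho (real_complex R x); rewrite eigenvalue_map => /(_ Ax).
rewrite ger0_norm; last by rewrite -[0]/(real_complex R 0) lecR ltW.
by rewrite lecR => /le_trans/(_ rho1); rewrite leNgt x1.
Qed.

Lemma limn_einf_gt0 (R : realType) (u : nat -> R) :
  (0 < limn_einf (fun n => (u n)%:E))%E ->
  exists K c, 0 < c /\ forall n, (K <= n)%N -> c <= u n.
Proof.
rewrite limn_einf_lim (cvg_lim _ (@cvg_einfs_sup _ _))// => /ereal_sup_gt[_ [K _ <-] pos].
have le n : (K <= n)%N -> (einfs (fun n => (u n)%:E) K <= (u n)%:E)%E.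
  by move=> Kn; apply: ereal_inf_lbound; exists n.
exists K; move: pos le; case: (einfs _ K) => [c| |]//.
- by rewrite lte_fin => c0 H; exists c; split=> // n /H; rewrite lee_fin.
- by move=> _ /(_ K (leqnn K)); rewrite leye_eq.
Qed.

Section Iteration.
Context {R : realType}.
Variable p : nat -> population -> R.
Hypotheses (Hp : progeny_law p) (Hrow : finite_row_sums p).
Local Notation G := (offspring_pgf p).

Let p_mass i : mass_function (p i) := progeny_mass_function Hp i.

(* Types at least k keep their initial value throughout the iteration. *)
Definition truncated_step k (s : nat -> R) i : R :=
  if (i < k)%N then G s i else s i.

Variable g : nat -> R.
Hypotheses (g01 : unit_valued g) (Gg : forall i, G g i <= g i).

Local Notation y k n := (iter n (truncated_step k) g).

Lemma truncated_unit_valued k n : unit_valued (y k n).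
Proof.
elim: n => //= n IH i; rewrite /truncated_step; case: ifP => // _.
exact: step_unit_valued.
Qed.

Lemma truncated_out k n i : (k <= i)%N -> y k n i = g i.
Proof. by move=> ki; elim: n => //= n IH; rewrite /truncated_step ltnNge ki. Qed.

(** The first step decreases by [Gg], and monotonicity of generating functions propagates this. *)
Lemma truncated_decr k n i : y k n.+1 i <= y k n i.
Proof.
elim: n i => [|n IH] i /=; first by rewrite /truncated_step; case: ifP.
rewrite [leLHS]/truncated_step [leRHS]/truncated_step; case: ifP => _; last exact: IH.
apply: (pgf_le (p_mass i)) => [j|]; last exact: truncated_unit_valued.
by rewrite IH andbT; have /andP[] := @truncated_unit_valued k n.+1 j.
Qed.

Lemma truncated_super k n i : (i < k)%N -> pgf (p i) (y k n) <= y k n i.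
Proof.
by move=> ik; have := truncated_decr k n i; rewrite /= /truncated_step ik.
Qed.

(** The truncation is not felt at i once k > i; bounded convergence inside the generating function
    gives the induction. *)
Lemma cvg_truncated n i : (fun k => y k n i) @ \oo --> iter n G g i.
Proof.
elim: n i => [|n IH] i; first exact: cvg_cst.
have H : (fun k => pgf (p i) (y k n)) @ \oo --> pgf (p i) (iter n G g).
  apply: (cvg_pgf (p_mass i)) => [k||//]; first exact: truncated_unit_valued.
  exact: iter_step_unit_valued.
apply: cvg_trans H; apply: near_eq_cvg; exists i.+1 => // k /= ik.
by rewrite /truncated_step ik.
Qed.

End Iteration.

Section Roots.
Context {R : realType}.
Implicit Type s : nat -> R.

(* The power s^(2^-m). *)
Definition iter_sqrt m s := iter m (fun t j => Num.sqrt (t j)) s.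

Lemma iter_sqrt_unit_valued m s : unit_valued s -> unit_valued (iter_sqrt m s).
Proof. by move=> s01; elim: m => //= m; exact: sqrt_unit_valued. Qed.

(** From 1 - x = (1 - sqrt x) (1 + sqrt x) and sqrt x >= x >= c, each root contracts the distance to
    1 by the factor 1 / (1 + c), uniformly in the type. *)
Lemma compl_iter_sqrt m s c : unit_valued s -> 0 < c -> (forall j, c <= s j) ->
  forall j, c <= iter_sqrt m s j /\ 1 - iter_sqrt m s j <= (1 + c)^-1 ^+ m.
Proof.
move=> s01 c0 cs j; elim: m => [|m [IHc IH]].
  by split=> //=; rewrite expr0; have := cs j; rewrite /iter_sqrt/=; lra.
have /andP[x0 x1] := iter_sqrt_unit_valued m s01 j.
rewrite /iter_sqrt/= -/(iter_sqrt m s j); set x := iter_sqrt m s j in IHc IH x0 x1 *.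
have sx0 : 0 <= Num.sqrt x := sqrtr_ge0 x.
have sx1 : Num.sqrt x <= 1 by rewrite -[leRHS]sqrtr1 ler_wsqrtr.
have xx : Num.sqrt x * Num.sqrt x = x by rewrite -expr2 sqr_sqrtr.
have xs : x <= Num.sqrt x by rewrite -{1}xx ler_piMr.
split; first exact: le_trans xs.
rewrite exprS mulrC ler_pdivlMr; last by rewrite ltr_wpDr// ltW.
apply: le_trans IH; rewrite -{2}xx; nra.
Qed.

Lemma iter_sqrt_near1 s c delta : unit_valued s -> 0 < c ->
  (forall j, c <= s j) -> 0 < delta ->
  exists m, forall j, 1 - iter_sqrt m s j <= delta.
Proof.
move=> s01 c0 cs delta0.
have : `|(1 + c)^-1| < 1.
  have c1 : 0 < 1 + c by lra.
  by rewrite ger0_norm ?invr_ge0 ?ltW// invf_lt1//; lra.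
move=> /cvg_expr/cvgrPdist_lt/(_ _ delta0)[m _ /(_ m (leqnn m))] /=.
rewrite sub0r normrN => /ltW H; exists m => j.
apply: le_trans (compl_iter_sqrt m s01 c0 cs j).2 _.
exact: le_trans (ler_norm _) H.
Qed.

End Roots.

Section Extinction.
Context {R : realType} {d : measure_display} {T : measurableType d}.
Variable P : probability T R.
Variables (p : nat -> population -> R)
  (xi : nat -> nat -> nat -> T -> population).
Hypotheses (Hp : progeny_law p) (Hrow : finite_row_sums p)
  (Hxi : offspring_family P p xi).
Local Notation G := (offspring_pgf p).
Local Notation q := (ext P xi).
Local Notation ext_by := (fun n => iter n G (fun=> 0)).

Let p_mass i : mass_function (p i) := progeny_mass_function Hp i.
Let q01 : unit_valued q := ext_unit_valued Hp Hxi.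

Lemma ext_fixed i : G q i = q i.
Proof.
have z01 : unit_valued (fun=> 0 : R) by move=> j; rewrite lexx ler01.
have H1 : (fun n => pgf (p i) (ext_by n)) @ \oo --> pgf (p i) q.
  apply: (cvg_pgf (p_mass i)) => // [n|j]; first exact: iter_step_unit_valued.
  exact: (cvg_ext Hp Hxi).
have H2 : (fun n => pgf (p i) (ext_by n)) @ \oo --> q i.
  have := @cvg_ext _ _ _ P p xi Hp Hxi i; rewrite -(cvg_shiftS (fun n => ext_by n i)) => H.
  exact: H.
exact: (cvg_unique _ H1 H2).
Qed.

(** Along an edge from j to x, q j = 1 would force the monomial of q to be 1 on the support,
    although some possible offspring contains x with q x < 1. *)
Lemma ext_lt1_path j i : has_path p j i -> q i < 1 -> q j < 1.
Proof.
move=> [s [ps <-]] {i}; elim: s j ps => [//|x s IH] j /= /andP[jx ps] /(IH _ ps) qx.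
have [r pr rx] := mean_progeny_gt0_ex Hp jx.
rewrite -ext_fixed lt_neqAle; have /andP[_ ->] := pgf01 (p_mass j) q01.
rewrite andbT; apply/eqP => Gq1.
have m01 := monomial01 q01.
have := @expect_eq _ _ _ (p_mass j) (monomial q) (fun=> 1) _ _ _ _ r pr.
rewrite -(meanE (p_mass j) m01) (expect_cst (p_mass j) ler01).
have -> : mean (p j) (monomial q) = 1 := Gq1.
have le_x := monomial_le_at q01 rx.
move=> H; move: le_x; rewrite H// ?leNgt ?qx// => z; by have /andP[] := m01 z.
Qed.

Lemma iter_sqrt_super m i : G (iter_sqrt m q) i <= iter_sqrt m q i.
Proof.
elim: m i => [|m IH] i; first by rewrite ext_fixed.
have s01 := iter_sqrt_unit_valued m q01.
have := le_trans (pgf_sqrt (p_mass i) s01) (IH i).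
have /andP[G0 _] := pgf01 (p_mass i) (iter_sqrt_unit_valued m.+1 q01).
move=> /ler_wsqrtr; rewrite sqrtr_sqr ger0_norm//.
Qed.

(** The difference is E[s^Z_n; Z_n <> 0] with s the m-th root. For m = 0 it is q - P(Z_n = 0), which
    tends to 0. By Cauchy-Schwarz under the law of Z_n, its square for m + 1 is at most its value
    for m. *)
Lemma cvg_iter_sqrt m i :
  (fun n => iter n G (iter_sqrt m q) i - ext_by n i) @ \oo --> (0 : R).
Proof.
elim: m => [|m IH].
  have Gq n : iter n G q = q.
    by elim: n => //= n ->; apply/funext => j; exact: ext_fixed.
  have H : (fun n => q i - ext_by n i) @ \oo --> q i - q i.
    by apply: cvgB; [exact: cvg_cst|exact: (@cvg_ext _ _ _ P p xi Hp Hxi i)].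
  rewrite subrr in H; apply: cvg_trans H; apply: near_eq_cvg.
  by apply: nearW => n; rewrite /iter_sqrt Gq.
apply/cvgrPdist_lt => e e0; have e20 : 0 < e ^+ 2 by rewrite exprn_gt0.
move/cvgrPdist_lt: IH => /(_ _ e20); apply: filterS => n.
rewrite !sub0r !normrN => /(le_lt_trans (ler_norm _)).
have s01 := iter_sqrt_unit_valued m q01.
have := pgf_sqrt_sub0 (gw_pmf Hp Hxi i n) s01.
rewrite (gw_law0 Hp Hxi) !(pgf_gw_law Hp Hxi)//; last exact: sqrt_unit_valued.
move=> /le_lt_trans/[apply].
by rewrite -(real_normK (num_real (_ - _))) ltr_pXn2r// nnegrE ?normr_ge0 ?ltW.
Qed.

Lemma ext_eventually_ge : (0 < limn_einf (global_ext P xi))%E ->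
  exists K c, 0 < c /\ forall n, (K <= n)%N -> c <= q n.
Proof.
move=> Hq; apply: limn_einf_gt0; move: Hq; congr (_ < limn_einf _)%E.
by apply/funext => n; rewrite (global_ext_fin Hp Hxi).
Qed.

Lemma ext_pos_lower_bound : (0 < limn_einf (global_ext P xi))%E ->
  (forall i, 0 < q i) -> exists2 c, 0 < c & forall i, c <= q i.
Proof.
move=> /ext_eventually_ge[K [c [c0 Hc]]] q0.
have [d0 d00 Hd] := @finite_pos_lower_bound R _ (fun i : 'I_K => q i) (fun i => q0 i).
exists (Num.min c d0); first by rewrite lt_min c0.
move=> i; rewrite ge_min; have [iK|/Hc->//] := ltnP i K.
by rewrite (ltW (Hd (Ordinal iK))) orbT.
Qed.

Hypothesis Hnonsing : forall C : {fset nat}, ~ final_class p C.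
Hypothesis Hsub : forall K : nat, exists k (alpha : 'rV[R]_k),
  [/\ (K <= k)%N, forall j, 0 <= alpha 0 j & no_eigenvalue_gt1 (aug_mean p alpha)].

Lemma ext_gt0 : (0 < limn_einf (global_ext P xi))%E -> forall i, 0 < q i.
Proof.
move=> Hq i0; have /andP[q0 _] := q01 i0.
rewrite lt_neqAle q0 andbT eq_sym; apply/eqP => qi0.
have [K [c [c0 Hc]]] := ext_eventually_ge Hq.
(* k >= K makes y = 1 outside the first k types, and k > i0 keeps the zero of q inside. *)
have [k [alpha [Kk alpha0 HA]]] := Hsub (maxn K i0.+1).
move: Kk; rewrite geq_max => /andP[Kk i0k].
pose y j : R := (q j != 0)%:R.
have y01 : unit_valued y by move=> j; rewrite /y; case: eqP; rewrite lexx ler01.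
have [||//|C sC] := singular_of_supersolution Hp Hrow alpha0 HA y01 (k := k).
- move=> i ik; rewrite {2}/y; have [qi|_] := eqVneq (q i) 0; last first.
    by have /andP[] := pgf01 (p_mass i) y01.
  have m01 := monomial01 q01; have m01y := monomial01 y01.
  (* When q i = 0, every possible offspring of i contains a type where q, and hence y, vanishes. *)
  have Eq0 : expect (p i) (monomial q) = 0%E.
    rewrite -(meanE (p_mass i) m01); congr EFin; exact: (etrans (ext_fixed i) qi).
  rewrite /pgf /mean (@eq_expect_support _ _ _ (fun=> 0) (p_mass i).1); last first.
    move=> r pr; have f0 z : (0 <= (p i z * monomial q z)%:E)%E.
      by rewrite lee_fin mulr_ge0 ?(p_mass i).1//; have /andP[] := m01 z.
    have /eqP := esum_eq0 f0 Eq0 r.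
    rewrite eqe mulf_eq0 gt_eqF//= /monomial prodf_seq_eq0 => /hasP[x xr /= /eqP qx].
    apply/eqP; rewrite prodf_seq_eq0; apply/hasP; exists x => //=.
    by rewrite /y qx eqxx.
  by rewrite (expect_cst (p_mass i) (lexx 0)).
- move=> j kj; left; rewrite /y gt_eqF//.
  by apply: lt_le_trans (Hc j _) => //; exact: leq_trans kj.
- by exists i0 => //; rewrite /y qi0 eqxx ltr01.
exact: (not_singular Hp Hrow Hnonsing Hsub sC).
Qed.

End Extinction.

(** * Choice of the constants and almost sure extinction *)

Theorem corollary3 (R : realType) (d : measure_display) (T : measurableType d)
    (P : probability T R)
    (p : nat -> population -> R)
    (xi : nat -> nat -> nat -> T -> population)
    (alpha : forall k : nat, 'rV[R]_k)
    (N1 N2 : nat) (a : R)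
    (Hp : progeny_law p)
    (Hrow : finite_row_sums p)
    (Hnonsing : forall C : {fset nat}, ~ final_class p C)
    (Hxi : offspring_family P p xi)
    (Hq : (0 < limn_einf (global_ext P xi))%E)
    (Halpha : forall k : nat, (1 <= k)%N -> distribution_row (alpha k))
    (HN1 : (1 <= N1)%N) (HN2 : (1 <= N2)%N) (Ha : 0 < a)
    (Hmass : forall k : nat, (N2 <= k)%N ->
       a <= \sum_(j < k | (j < minn N1 k)%N) alpha k ord0 j)
    (Hcase :
       (forall j : nat, (j < N1)%N -> (partial_ext P xi j < 1)%E) \/
       ((forall j : nat, (j < N1)%N -> partial_ext P xi j = 1%E) /\
        (forall j i : nat, (j < N1)%N -> has_path p j i)))
    (Hrho : forall K : nat, exists k : nat,
       [/\ (K <= k)%N, (1 <= k)%N &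
           exists rho : R,
             is_PF_eigenvalue (aug_mean p (alpha k)) rho /\ rho <= 1]) :
  forall i : nat, global_ext P xi i = 1%E.
Proof.
have Hsub K : exists k, [/\ (K <= k)%N, (1 <= k)%N, forall j, 0 <= alpha k 0 j &
    no_eigenvalue_gt1 (aug_mean p (alpha k))].
  have [k [Kk k1 [rho [Arho rho1]]]] := Hrho K; exists k; split=> //.
    exact: (Halpha k k1).1.
  exact: PF_no_eigenvalue_gt1 Arho rho1.
have Hsub' K : exists k (alpha : 'rV[R]_k), [/\ (K <= k)%N,
    forall j, 0 <= alpha 0 j & no_eigenvalue_gt1 (aug_mean p alpha)].
  by have [k [Kk k1 alpha0 HA]] := Hsub K; exists k, (alpha k); split.
pose q := ext P xi; pose G := offspring_pgf p.
have q01 : unit_valued q := ext_unit_valued Hp Hxi.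
have q0 := ext_gt0 Hp Hrow Hxi Hnonsing Hsub' Hq.
have [c c0 qc] := ext_pos_lower_bound Hp Hxi Hq q0.
move=> i0; rewrite (global_ext_fin Hp Hxi); congr EFin.
apply/eqP; rewrite eq_le; have /andP[_ ->] := q01 i0; rewrite leNgt; apply/negP => qi0.
(* In case (a) q is bounded by the partial extinction probability; in case (b) a path leads from j
   to i0, where q < 1. *)
have qN1 (j : 'I_N1) : q j < 1.
  case: Hcase => [Ha1|[_ Hpath]]; last exact: (ext_lt1_path Hp Hxi (Hpath j i0 (ltn_ord j))).
  rewrite -lte_fin; apply: le_lt_trans (Ha1 j (ltn_ord j)).
  exact: (ext_le_partial_ext Hp Hxi).
have [|eta eta0 Heta] := @finite_pos_lower_bound R _ (fun j : 'I_N1 => 1 - q j).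
  by move=> j; rewrite subr_gt0.
(* Outside the truncation 1 - g is then at most a eta / 4, strictly below the average a eta / 2 of
   [alpha_y]. *)
have delta0 : 0 < a * eta / 4 by rewrite !mulr_gt0// invr_gt0.
have [m Hm] := iter_sqrt_near1 q01 c0 qc delta0.
set g := iter_sqrt m q in Hm.
have g01 : unit_valued g := iter_sqrt_unit_valued m q01.
have Gg i : G g i <= g i := iter_sqrt_super Hp Hxi m i.
have eta4 : 0 < eta / 4 by rewrite divr_gt0.
(* An error eta / 4 here and another from the truncation below leave 1 - y >= eta / 2 on the first
   N1 types. *)
have [n Hn] : exists n, forall j : 'I_N1, iter n G g j < q j + eta / 4.
  have : \forall n \near \oo, forall j : 'I_N1, iter n G g j < q j + eta / 4.
    apply: filter_forall => j.
    have := cvg_iter_sqrt Hp Hxi m j.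
    move=> /cvgrPdist_lt/(_ _ eta4); apply: filterS => n.
    rewrite sub0r normrN => /(le_lt_trans (ler_norm _)).
    have : iter n G (fun=> 0) j <= q j.
      exact: ext_by_le.
    rewrite -/g -/G; lra.
  by move=> [n _ /(_ n (leqnn n))]; exists n.
have [K HK] : exists K, forall k, (K <= k)%N -> forall j : 'I_N1,
    iter n (truncated_step p k) g j < q j + eta / 2.
  have : \forall k \near \oo, forall j : 'I_N1,
      iter n (truncated_step p k) g j < q j + eta / 2.
    apply: filter_forall => j.
    have := @cvg_truncated _ _ Hp _ g01 n j.
    move=> /cvgrPdist_lt/(_ _ eta4); apply: filterS => k.
    rewrite distrC => /(le_lt_trans (ler_norm _)); have := Hn j; rewrite -/G; lra.
  by move=> [K _ HK]; exists K.
have [k [Kk k1 alpha0 HA]] := Hsub (maxn K (maxn N1 N2)).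
move: Kk; rewrite !geq_max => /and3P[Kk N1k N2k].
set y := iter n (truncated_step p k) g.
have y01 : unit_valued y by exact: truncated_unit_valued.
have yN1 (j : nat) : (j < N1)%N -> eta / 2 <= 1 - y j.
  by move=> jN; have := HK k Kk (Ordinal jN); have := Heta (Ordinal jN); rewrite /= -/y; lra.
have alpha_y : a * eta / 2 <= \sum_l alpha k 0 l * (1 - y l).
  (* Only the first N1 types are kept: they have alpha-mass at least a. *)
  apply: (@le_trans _ _ (\sum_(l < k | (l < minn N1 k)%N) alpha k 0 l * (eta / 2))).
    by rewrite -mulr_suml -mulrA ler_wpM2r ?Hmass// divr_ge0 ?ltW.
  rewrite big_mkcond/=; apply: ler_sum => l _; case: ifP => [|_].
    by rewrite leq_min => /andP[lN _]; rewrite ler_wpM2l// yN1.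
  by rewrite mulr_ge0// subr_ge0; have /andP[] := y01 l.
have [|||C sC] := singular_of_supersolution Hp Hrow alpha0 HA y01.
- by move=> i ik; exact: truncated_super.
- move=> j kj; right; rewrite /y truncated_out//.
  by apply: le_lt_trans (Hm j) _; apply: lt_le_trans alpha_y; lra.
- by exists 0%N => //; have := yN1 0%N HN1; lra.
exact: (not_singular Hp Hrow Hnonsing Hsub' sC).
Qed.
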